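(* Let $d\ge1$, let $J:\mathbb{Z}^d\to[0,\infty)$ be symmetric and integrable with $\beta_c=\beta_c(J)<\infty$, and consider (long-range or nearest-neighbour) percolation on $\mathbb{Z}^d$ with intensity $J$. Suppose that the critical exponents $\delta$ and $\eta$ are both well-defined, i.e. that there exist real numbers $\delta>0$ and $\eta$ such that \[ \mathbf{P}_{\beta_c}(|K_0|\ge n)\approx n^{-1/\delta}\ \text{ as } n\to\infty \qquad\text{and}\qquad \mathbf{P}_{\beta_c}(x\leftrightarrow y)\approx \|x-y\|^{-d+2-\eta}\ \text{ as } \|x-y\|\to\infty . \] Then \[ (2-\eta)(\delta+1)\le d(\delta-1). \]
   Context: A function $J:\mathbb{Z}^d\to[0,\infty)$ is symmetric if $J(x)=J(-x)$ for every $x$, and integrable if $\sum_{x}J(x)<\infty$. For $\beta\ge 0$, percolation on $\mathbb{Z}^d$ with intensity $J$ is the random graph with vertex set $\mathbb{Z}^d$ in which each potential edge $\{x,y\}$ is included independently with probability $1-\exp(-\beta J(y-x))$; its law is $\mathbf{P}_\beta$. (Nearest-neighbour percolation is the case $J(x)=\mathbb{1}(\|x\|_1=1)$.) Connected components are called clusters; $K_0$ is the cluster of the origin, $|K_0|$ its number of vertices, and $\{x\leftrightarrow y\}$ is the event that $x$ and $y$ are in the same cluster. $\beta_c=\sup\{\beta\ge 0:\mathbf{P}_\beta\text{ is supported on configurations with no infinite clusters}\}$. The notation $\approx$ means that the ratio of the logarithms of the two sides tends to $1$ in the relevant limit. *)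

(* Defs.v *)
From HB Require Import structures.
From mathcomp Require Import all_boot all_order all_algebra.
From mathcomp Require Import finmap.
From mathcomp Require Import all_classical all_reals all_analysis.
Set Implicit Arguments.
Unset Strict Implicit.
Unset Printing Implicit Defensive.
Import Order.TTheory GRing.Theory Num.Theory.
Import numFieldNormedType.Exports.
Local Open Scope classical_set_scope.
Local Open Scope ring_scope.

Notation lattice d := 'rV[int]_d.

(* Unordered pairs of distinct vertices. *)
Definition edge (d : nat) : Type :=
  {e : {fset lattice d} | #|` e| == 2}.

(* A configuration is the set of its open edges. *)
Definition open_edge (d : nat) (e : edge d) : set (set (edge d)) :=
  [set w | w e].

(* The product sigma-algebra on {0,1}^E. *)
Definition config (d : nat) :=
  g_sigma_algebraType [set open_edge e | e in [set: edge d]].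

Section Graph.
Variable d : nat.
Implicit Types (w : config d) (x y : lattice d).

Definition adjacent w x y : Prop :=
  exists2 e : edge d, val e = [fset x; y]%fset & w e.

Definition connected_in w x y : Prop :=
  exists2 p : seq (lattice d),
    path (fun u v => `[< adjacent w u v >]) x p & last x p = y.

Definition cluster w x : set (lattice d) := [set y | connected_in w x y].

Definition no_infinite_cluster w : Prop :=
  forall x, finite_set (cluster w x).

End Graph.

(* [`I_n #<= A] says that A has at least n elements, A being possibly
   infinite. *)
Definition cluster_ge (d : nat) (n : nat) : set (config d) :=
  [set w | (`I_n #<= cluster w 0)%card].
Arguments cluster_ge : clear implicits.

Definition connection (d : nat) (x y : lattice d) : set (config d) :=
  [set w | connected_in w x y].
Arguments connection {d} x y.

Section Law.
Variable R : realType.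

Definition mutually_independent (dsp : measure_display)
    (T : measurableType dsp) (P : probability T R) (I : choiceType)
    (E : I -> set T) : Prop :=
  forall A : {fset I},
    P (\bigcap_(i in [set` A]) E i) = (\prod_(i <- A) P (E i))%E.

(* These two conditions determine P, since the finite intersections of the
   sets [open_edge e] form a pi-system generating the sigma-algebra. *)
Definition percolation_law (d : nat) (J : lattice d -> R) (beta : R)
    (P : probability (config d) R) : Prop :=
  (forall (e : edge d) (x y : lattice d), val e = [fset x; y]%fset ->
     P (open_edge e) = (1 - expR (- (beta * J (y - x))))%:E) /\
  mutually_independent P (@open_edge d).

Definition beta_c (d : nat) (P : R -> probability (config d) R) : \bar R :=
  ereal_sup [set beta%:E | beta in
    [set beta : R | 0 <= beta /\
       {ae P beta, forall w, no_infinite_cluster w}]].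

Definition euclidean_norm (d : nat) (x : lattice d) : R :=
  Num.sqrt (\sum_(i < d) (x 0 i)%:~R ^+ 2).

(* The limit ||x - y|| -> oo, on pairs (x, y). *)
Definition far_apart (d : nat) : set_system (lattice d * lattice d) :=
  filter_from [set: R]
    (fun M => [set xy | M < euclidean_norm (xy.1 - xy.2)]).
Arguments far_apart : clear implicits.

#[global] Instance far_apart_filter (d : nat) : Filter (far_apart d).
Proof.
apply: filter_from_filter; first by exists 0.
move=> M N _ _; exists (Num.max M N) => // xy /=.
by rewrite gt_max => /andP[].
Qed.

Definition log_equiv (T : Type) (F : set_system T) (f g : T -> R) : Prop :=
  (fun t => ln (f t) / ln (g t)) @ F --> (1 : R).

End Law.

Arguments far_apart : clear implicits.
Arguments euclidean_norm R {d} x.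

(* Main.v *)
Require Import Defs.
From HB Require Import structures.
From mathcomp Require Import all_boot all_order all_algebra.
From mathcomp Require Import finmap.
From mathcomp Require Import all_classical all_reals all_analysis.
From mathcomp Require Import ring lra zify.
Set Implicit Arguments.
Unset Strict Implicit.
Unset Printing Implicit Defensive.
Import Order.TTheory GRing.Theory Num.Theory.
Import numFieldNormedType.Exports.
Local Open Scope classical_set_scope.
Local Open Scope ring_scope.

(** Let [q n = P(|K_0| >= n)]. A cluster with [3 n] marked vertices can be cut
    into two edge-disjoint connected pieces carrying [n] marked vertices each, so
    by the van den Berg-Kesten inequality the probability [A n] that some cluster
    has at least [n] vertices in a given box satisfies [A (3 n) <= A n ^ 2]. As
    [A n <= volume * q n / n] by Markov's inequality, in a box of side [r] a few
    squarings make [A n] smaller than any given power of [r] once [n] slightly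
    exceeds [r ^ (d delta / (delta + 1))]. Up to this truncation the mean number
    [r ^ (2 - eta)] of vertices of the box connected to [0] is the sum of [q n]
    over smaller [n], of order [r ^ (d (delta - 1) / (delta + 1))].

    This uses [delta >= 1]. Otherwise, cutting the cluster of [0] at a vertex [v]
    and summing over [v] gives [q (3 n) <= q n * E(|K_0|; |K_0| >= n)], whose last
    factor decays polynomially, and [q] could not be a power law. *)

(** * The van den Berg-Kesten inequality for finite products *)

Section FiniteProduct.
Variables (R : realType) (E : choiceType) (p : E -> R).
Hypothesis p01 : forall e, 0 <= p e <= 1.
Implicit Types (l : seq E) (Q : set E -> Prop) (D : set E -> set E -> Prop).

Definition increasing (T : Type) (Q : set T -> Prop) :=
  forall A B, A `<=` B -> Q A -> Q B.

Definition increasing2 (T : Type) (D : set T -> set T -> Prop) :=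
  forall A B A' B', A `<=` A' -> B `<=` B' -> D A B -> D A' B'.

(** Disjoint occurrence in the sense of van den Berg and Kesten, for a joint condition [D] on the
    two witnesses: the sections met in the induction are no longer of product form. *)
Definition disjointly (T : Type) (D : set T -> set T -> Prop) (A : set T) :=
  exists S T, [/\ S `<=` A, T `<=` A, S `&` T = set0 & D S T].

(** The law of a random subset of [l] keeping each [e] independently with probability [p e],
    unfolded one element at a time to suit induction on [l]. *)
Fixpoint prob l Q : R :=
  if l is e :: l' then
    (1 - p e) * prob l' Q + p e * prob l' (fun A => Q (e |` A))
  else (`[< Q set0 >])%:R.

(** Two independent copies of that random set; the terms are the four joint states of [e]. *)
Fixpoint prob2 l D : R :=
  if l is e :: l' then
    (1 - p e) ^+ 2 * prob2 l' D
    + p e * (1 - p e) * (prob2 l' (fun A B => D (e |` A) B)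
                         + prob2 l' (fun A B => D A (e |` B)))
    + p e ^+ 2 * prob2 l' (fun A B => D (e |` A) (e |` B))
  else (`[< D set0 set0 >])%:R.

Lemma le_prob l Q Q' : (forall A, Q A -> Q' A) -> prob l Q <= prob l Q'.
Proof.
elim: l Q Q' => [|e l IH] Q Q' QQ' /=.
  by rewrite ler_nat; case: asboolP => // /QQ' /asboolP ->.
have /andP[p0 p1] := p01 e.
by apply: lerD; apply: ler_wpM2l; rewrite ?subr_ge0//; apply: IH => // A /QQ'.
Qed.

Lemma le_prob2 l D D' : (forall A B, D A B -> D' A B) -> prob2 l D <= prob2 l D'.
Proof.
elim: l D D' => [|e l IH] D D' DD' /=.
  by rewrite ler_nat; case: asboolP => // /DD' /asboolP ->.
have /andP[p0 p1] := p01 e; have q0 : 0 <= 1 - p e by rewrite subr_ge0.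
apply: lerD; [apply: lerD|]; apply: ler_wpM2l; rewrite ?exprn_ge0 ?mulr_ge0//.
- exact: IH.
- by apply: lerD; apply: IH => A B /DD'.
- by apply: IH => A B /DD'.
Qed.

Lemma prob2UI l D D' :
  prob2 l (fun A B => D A B \/ D' A B) + prob2 l (fun A B => D A B /\ D' A B)
  = prob2 l D + prob2 l D'.
Proof.
elim: l D D' => [|e l IH] D D' /=.
  rewrite asbool_or asbool_and.
  by case: asboolP; case: asboolP; rewrite /= ?addr0 ?add0r.
have := IH D D'.
have := IH (fun A B => D (e |` A) B) (fun A B => D' (e |` A) B).
have := IH (fun A B => D A (e |` B)) (fun A B => D' A (e |` B)).
have := IH (fun A B => D (e |` A) (e |` B)) (fun A B => D' (e |` A) (e |` B)).
set a := prob2 _ _; set b := prob2 _ _; set c := prob2 _ _; set d := prob2 _ _.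
move=> h1.
set a2 := prob2 _ _; set b2 := prob2 _ _; set c2 := prob2 _ _; set d2 := prob2 _ _.
move=> h2.
set a3 := prob2 _ _; set b3 := prob2 _ _; set c3 := prob2 _ _; set d3 := prob2 _ _.
move=> h3.
set a4 := prob2 _ _; set b4 := prob2 _ _; set c4 := prob2 _ _; set d4 := prob2 _ _.
move=> h4.
have -> : a = c + d - b by rewrite -h1 addrK.
have -> : a2 = c2 + d2 - b2 by rewrite -h2 addrK.
have -> : a3 = c3 + d3 - b3 by rewrite -h3 addrK.
have -> : a4 = c4 + d4 - b4 by rewrite -h4 addrK.
by ring.
Qed.

Lemma prob2M l Q Q' : prob2 l (fun A B => Q A /\ Q' B) = prob l Q * prob l Q'.
Proof.
elim: l Q Q' => [|e l IH] Q Q' /=.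
  by rewrite asbool_and; do 2 case: asboolP; rewrite ?mulr0 ?mulr1.
by rewrite !IH; ring.
Qed.

(** Disjoint witnesses cannot both contain [e], so [e] can be removed from both and put back on a
    single side. *)
Lemma disjointly_setU1 D e A : increasing2 D -> disjointly D (e |` A) ->
  disjointly (fun S T => D (e |` S) T \/ D S (e |` T)) A.
Proof.
move=> upD [S [T [SA TA ST0 DST]]].
have sub (X : set E) : X `<=` e |` A -> X `\ e `<=` A.
  by move=> XA x [/XA[xe|//] /(_ xe)].
exists (S `\ e), (T `\ e); split; [exact: sub|exact: sub| |].
- by apply/seteqP; split=> // x [[Sx _] [Tx _]]; rewrite -ST0.
- have subU (X : set E) : X `<=` e |` (X `\ e).
    by move=> x Xx; have [->|/eqP xe] := eqVneq x e; [left|right].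
  have nT : T e -> S `<=` S `\ e.
    move=> Te x Sx; split=> // xe; suff : (S `&` T) x by rewrite ST0.
    by split=> //; rewrite xe.
  have nT' : ~ T e -> T `<=` T `\ e.
    by move=> Te x Tx; split=> // xe; apply: Te; rewrite -xe.
  case: (pselect (T e)) => Te; [right|left]; apply: upD DST.
  + exact: nT.
  + exact: subU.
  + exact: subU.
  + exact: nT'.
Qed.

(* Splitting on one coordinate [e] replaces [D] by its four sections [D_ab],
   and the union [D_10 \/ D_01], in which [e] is used on one side only, is
   controlled by inclusion-exclusion. *)
Lemma prob_disjointly l D : increasing2 D -> prob l (disjointly D) <= prob2 l D.
Proof.
elim: l D => [|e l IH] D upD /=.
  rewrite ler_nat; case: asboolP => // -[S [T [+ + _]]].
  by rewrite !subset0 => -> -> /asboolP ->.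
have /andP[p0 p1] := p01 e.
pose D00 := D; pose D10 A B := D (e |` A) B; pose D01 A B := D A (e |` B).
pose D11 A B := D (e |` A) (e |` B).
have U1 (A B : set E) : A `<=` B -> e |` A `<=` e |` B by move=> AB; exact: setUS.
have upU : increasing2 (fun A B => D10 A B \/ D01 A B).
  by move=> A B A' B' AA' BB' [h|h]; [left|right]; apply: upD h => //; exact: U1.
have h0 := IH _ upD; have h1 := IH _ upU.
have hUI := prob2UI l D10 D01.
have hI : prob2 l D00 <= prob2 l (fun A B => D10 A B /\ D01 A B).
  by apply: le_prob2 => A B h; split; apply: upD h => // x; right.
have hU : prob2 l (fun A B => D10 A B \/ D01 A B) <= prob2 l D11.
  by apply: le_prob2 => A B [h|h]; apply: upD h => // x; right.
have hd : prob l (fun A => disjointly D (e |` A)) <=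
    prob l (disjointly (fun A B => D10 A B \/ D01 A B)).
  by apply: le_prob => A; exact: disjointly_setU1.
rewrite -/D10 -/D01 -/D11 in hd h1 *.
set f0 := prob l _ in h0 *; set f1 := prob l _ in hd *.
set f2 := prob l _ in h1 hd.
set g0 := prob2 l D in h0 hI *; set gU := prob2 l _ in h1 hUI hU.
set gI := prob2 l _ in hUI hI; set g10 := prob2 l D10 in hUI *.
set g01 := prob2 l D01 in hUI *; set g11 := prob2 l D11 in hU *.
have a1 : (1 - p e) * f0 <= (1 - p e) * g0 by rewrite ler_wpM2l ?subr_ge0.
have a2 : p e * f1 <= p e * gU.
  by rewrite ler_wpM2l// (le_trans hd).
(* After inclusion-exclusion, [a3] and [a4] add up exactly to the gap between the bound wanted and
   the bound given by [a1] and [a2]. *)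
have a3 : 0 <= p e * (1 - p e) * (gI - g0).
  by rewrite !mulr_ge0 ?subr_ge0.
have a4 : 0 <= p e ^+ 2 * (g11 - gU) by rewrite mulr_ge0 ?exprn_ge0 ?subr_ge0.
have -> : g10 + g01 = gU + gI by [].
apply: (le_trans (lerD a1 a2)); rewrite -subr_ge0.
have := addr_ge0 a3 a4; congr (0 <= _); ring.
Qed.

Lemma prob_BK l Q Q' : increasing Q -> increasing Q' ->
  prob l (disjointly (fun A B => Q A /\ Q' B)) <= prob l Q * prob l Q'.
Proof.
move=> uQ uQ'; rewrite -prob2M; apply: prob_disjointly => A B A' B' AA' BB' [? ?].
by split; [exact: uQ AA' _|exact: uQ' BB' _].
Qed.

End FiniteProduct.

Lemma prob_map (R : realType) (E : choiceType) (p : E -> R) (s : E -> E) l Q :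
  (forall e, p (s e) = p e) ->
  prob p (map s l) Q = prob p l (fun A => Q (s @` A)).
Proof.
move=> ps; elim: l Q => [|e l IH] Q /=; first by rewrite image_set0.
rewrite ps !IH; congr (_ + _ * _); congr (prob p l _).
by apply/funext => A; rewrite image_setU image_set1.
Qed.

(** * Splitting a cluster into edge-disjoint pieces *)

Section Connectivity.
Variable d : nat.
Implicit Types (w : set (edge d)) (x y z u v : lattice d) (T : {fset edge d}).

Lemma adjacent_sym w x y : Defs.adjacent w x y -> Defs.adjacent w y x.
Proof. by move=> [e exy we]; exists e => //; rewrite exy fsetUC. Qed.

Lemma connected_in_refl w x : connected_in w x x.
Proof. by exists [::]. Qed.

Lemma connected_in_step w x y z :
  connected_in w x y -> Defs.adjacent w y z -> connected_in w x z.
Proof.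
move=> [s xs <-] yz; exists (rcons s z); last by rewrite last_rcons.
by rewrite rcons_path xs; apply/asboolP.
Qed.

Lemma connected_in_ind w x (P : lattice d -> Prop) : P x ->
  (forall y z, connected_in w x y -> P y -> Defs.adjacent w y z -> P z) ->
  forall y, connected_in w x y -> P y.
Proof.
move=> Px IH y [s + <-]; elim/last_ind: s => [//|s z IHs].
rewrite rcons_path last_rcons => /andP[xs /asboolP sz].
by apply: IH (IHs xs) sz; exists s.
Qed.

Lemma connected_in_trans w x y z :
  connected_in w x y -> connected_in w y z -> connected_in w x z.
Proof.
move=> xy; move: z; apply: connected_in_ind => // y' z _; exact: connected_in_step.
Qed.

Lemma connected_in_adj w x y : Defs.adjacent w x y -> connected_in w x y.
Proof. by apply: connected_in_step; exact: connected_in_refl. Qed.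

Lemma connected_in_sym w x y : connected_in w x y -> connected_in w y x.
Proof.
move: y; apply: connected_in_ind => [|y z _ yx yz]; first exact: connected_in_refl.
by apply: connected_in_trans yx; apply/connected_in_adj/adjacent_sym.
Qed.

Lemma connected_in_le w w' x y : w `<=` w' -> connected_in w x y ->
  connected_in w' x y.
Proof.
move=> ww'; move: y; apply: connected_in_ind => [|y z _ xy [e eyz we]].
  exact: connected_in_refl.
by apply: connected_in_step xy _; exists e => //; exact: ww'.
Qed.

Lemma connected_in_first w x y :
  connected_in w x y -> x = y \/ exists z, Defs.adjacent w x z.
Proof.
move: y; apply: connected_in_ind => [|y z _ [->|h] yz]; first by left.
  by right; exists z.
by right.
Qed.

Lemma connected_in_finite w x y : connected_in w x y ->
  exists2 T : {fset edge d}, [set` T] `<=` w & connected_in [set` T] x y.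
Proof.
move: y; apply: connected_in_ind => [|y z _ [T Tw xy] [e eyz we]].
  by exists fset0; [by move=> e /=; rewrite in_fset0|]; exact: connected_in_refl.
exists (e |` T)%fset; first by move=> f /=; rewrite in_fset1U => /predU1P[->|/Tw].
apply: (@connected_in_step _ _ y).
  by apply: connected_in_le xy => f /= fT; rewrite in_fset1U fT orbT.
by exists e => //=; rewrite in_fset1U eqxx.
Qed.

(** [V] is the set of marked vertices. A duplicate-free list as witness makes the event depend on
    finitely many open edges, even when the cluster is infinite. *)
Definition reach_ge (V : set (lattice d)) (n : nat) x w : Prop :=
  exists s : seq (lattice d),
    [/\ uniq s, size s = n & forall y, y \in s -> V y /\ connected_in w x y].

Lemma reach_ge_le V n x w w' : w `<=` w' -> reach_ge V n x w -> reach_ge V n x w'.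
Proof.
move=> ww' [s [us sn h]]; exists s; split=> // y /h[Vy xy]; split=> //.
exact: connected_in_le xy.
Qed.

Lemma reach_geW V n m x w : (n <= m)%N -> reach_ge V m x w -> reach_ge V n x w.
Proof.
move=> nm [s [us sm h]]; exists (take n s); split.
- exact: take_uniq.
- by rewrite size_take sm; case: ltngtP nm => // ->.
- by move=> y /mem_take /h.
Qed.

Lemma reach_ge_sub V V' n x w : V `<=` V' -> reach_ge V n x w -> reach_ge V' n x w.
Proof. by move=> VV' [s [us sn h]]; exists s; split=> // y /h[/VV']. Qed.

Lemma reach_ge_count V n x w (s : seq (lattice d)) : uniq s ->
  (forall y, y \in s -> V y) ->
  (n <= count (fun y => `[< connected_in w x y >]) s)%N -> reach_ge V n x w.
Proof.
move=> us sV ns; apply: (reach_geW ns).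
exists [seq y <- s | `[< connected_in w x y >]]; split.
- exact: filter_uniq.
- by rewrite size_filter.
- by move=> y; rewrite mem_filter => /andP[/asboolP xy /sV].
Qed.

Lemma reach_ge_finite V n x w : reach_ge V n x w ->
  exists2 T : {fset edge d}, [set` T] `<=` w & reach_ge V n x [set` T].
Proof.
move=> [s [us sn h]].
suff [T Tw xs] : exists2 T : {fset edge d}, [set` T] `<=` w &
    forall y, y \in s -> connected_in [set` T] x y.
  by exists T => //; exists s; split=> // y ys; split; [case: (h y ys)|exact: xs].
elim: s {us sn} h => [|y s IH] h; first by exists fset0 => // e /=; rewrite in_fset0.
have [z zs|T Tw xs] := IH; first by apply: h; rewrite inE zs orbT.
have [_ /connected_in_finite[T' Tw' xy]] := h y (mem_head _ _).
exists (T `|` T')%fset; first by move=> e /= /fsetUP[/Tw|/Tw'].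
move=> z; rewrite inE => /predU1P[->|/xs]; [move: xy|]; apply: connected_in_le => e /=.
  by rewrite inE => ->; rewrite orbT.
by rewrite inE => ->.
Qed.

(** After its last use of [e], a path from [v] starts afresh at [v] or at [v']. *)
Lemma connected_in_fsetD1 T e v v' : val e = [fset v; v']%fset ->
  forall y, connected_in [set` T] v y ->
  connected_in [set` (T `\ e)%fset] v y \/ connected_in [set` (T `\ e)%fset] v' y.
Proof.
move=> ev; apply: connected_in_ind => [|y z _ IH [f fyz /= fT]].
  by left; exact: connected_in_refl.
have [fe|fe] := eqVneq f e.
  have : z \in val e by rewrite -fe fyz !inE eqxx orbT.
  rewrite ev => /fset2P[]->; [left|right]; exact: connected_in_refl.
have yz : Defs.adjacent [set` (T `\ e)%fset] y z by exists f => //=; rewrite !inE fe fT.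
by case: IH => h; [left|right]; exact: connected_in_step h yz.
Qed.

(** * Separating the component of a vertex from the other edges *)

Section Component.
Variables (T : {fset edge d}) (v : lattice d).

Definition component_edges : {fset edge d} :=
  [fset f in T | `[< exists2 x, x \in val f & connected_in [set` T] v x >]]%fset.

Lemma connected_in_component y :
  connected_in [set` T] v y -> connected_in [set` component_edges] v y.
Proof.
move: y; apply: connected_in_ind => [|y z vy IH [f fyz fT]].
  exact: connected_in_refl.
apply: connected_in_step IH _; exists f => //=; rewrite !inE /=; apply/andP; split=> //.
by apply/asboolP; exists y => //; rewrite fyz !inE eqxx.
Qed.

(** A path from [v'] that met an edge of [component_edges] would join [v] to [v']. *)
Lemma connected_in_other_component v' y : ~ connected_in [set` T] v v' ->
  connected_in [set` T] v' y ->
  connected_in [set` (T `\` component_edges)%fset] v' y.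
Proof.
move=> vv'; move: y; apply: connected_in_ind => [|y z v'y IH yz].
  exact: connected_in_refl.
have [f fyz fT] := yz.
apply: connected_in_step IH _; exists f => //=; rewrite !inE /= fT andbT.
apply/negP => /andP[_ /asboolP[x + vx]]; rewrite fyz => /fset2P[] xE; apply: vv'.
  by apply: connected_in_trans (connected_in_sym v'y); rewrite -xE.
apply: connected_in_trans (connected_in_sym (connected_in_step v'y yz)).
by rewrite -xE.
Qed.

End Component.

(** * Cutting a finite connected edge set into two balanced pieces *)

Section Split.
Variables (w : {fset edge d}) (u : lattice d) (s : seq (lattice d)) (n : nat).
Hypotheses (us : uniq s) (n_gt0 : (0 < n)%N).

Let cnt T v := count (fun y => `[< connected_in [set` T] v y >]) s.
(** The invariant of a descent starting at [v = u] and [T = w]. Covering all of [s] is what turns an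
    upper bound on the count of [T] into a lower bound on that of its complement. *)
Let valid v T := [/\ (T `<=` w)%fset,
  connected_in [set` (w `\` T)%fset] u v,
  forall y, y \in s -> connected_in [set` (w `\` T)%fset] u y \/
                       connected_in [set` T] v y &
  (n <= cnt T v)%N].

(* As long as [T] carries at least [2 n] marked vertices, deleting an edge of
   [T] at [v] leaves at least [n] of them on one of the two sides. *)
Let valid_balanced v T : valid v T ->
  exists v' T', valid v' T' /\ (cnt T' v' < n.*2)%N.
Proof.
have [k] := ubnP #|` T|; elim: k => // k IH in v T *.
rewrite ltnS => Tk vT; have [lt|le] := ltnP (cnt T v) n.*2; first by exists v, T.
have [Tw uv cov cn] := vT.
(* Were [v] isolated in [T], it would reach only itself, and the count would be at most 1. *)
have [v' [e ev eT]] : exists v', Defs.adjacent [set` T] v v'.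
  apply: contrapT => nv; move: le; rewrite leqNgt => /negP; apply.
  suff : (cnt T v <= 1)%N by move/leq_ltn_trans; apply; lia.
  apply: (@leq_trans (count_mem v s)); last by rewrite count_uniq_mem// leq_b1.
  apply: sub_count => y /asboolP /connected_in_first[->|//]; exact: eqxx.
rewrite /= in eT.
pose T' := (T `\ e)%fset.
have T'k : (#|` T'| < k)%N.
  by rewrite (leq_trans _ Tk)// (cardfsD1 e T) eT add1n.
have T'T : (T' `<=` T)%fset by exact: fsubD1set.
have eC A : (A `<=` T')%fset -> Defs.adjacent [set` (w `\` A)%fset] v v'.
  move=> AT'; exists e => //=; rewrite !inE (fsubsetP Tw _ eT) andbT.
  by apply/negP => /(fsubsetP AT'); rewrite !inE eqxx.
have uvC A : (A `<=` T')%fset -> connected_in [set` (w `\` A)%fset] u v.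
  move=> AT'; apply: connected_in_le uv => f /=; rewrite !inE => /andP[fT ->].
  by rewrite andbT; apply: contra fT => /(fsubsetP AT') /(fsubsetP T'T).
have uC A y : (A `<=` T')%fset -> connected_in [set` (w `\` T)%fset] u y ->
    connected_in [set` (w `\` A)%fset] u y.
  move=> AT'; apply: connected_in_le => f /=; rewrite !inE => /andP[fT ->].
  by rewrite andbT; apply: contra fT => /(fsubsetP AT') /(fsubsetP T'T).
have T'w : (T' `<=` w)%fset by exact: fsubset_trans Tw.
have dich := connected_in_fsetD1 (T := T) ev; rewrite -/T' in dich.
(* If [v] and [v'] stay joined without [e], deleting [e] loses no vertex and [v] is kept. *)
have [vv'|vv'] := pselect (connected_in [set` T'] v v').
  have TT' y : connected_in [set` T] v y -> connected_in [set` T'] v y.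
    by move=> /dich[//|]; exact: connected_in_trans.
  apply: (IH v T') => //; split=> //.
  - exact: uvC.
  - by move=> y ys; case: (cov y ys) => [/uC|/TT']; [left; auto|right].
  - by apply: (leq_trans cn); apply: sub_count => y /asboolP/TT'/asboolP.
(* Otherwise the counts of [A] from [v] and of [B] from [v'] sum to at least [2 n], so one of them
   is at least [n]. That piece is kept; the other one goes to the complement together with [e],
   through which everything stays joined to [u]. *)
pose A := component_edges T' v; pose B := (T' `\` A)%fset.
have AT' : (A `<=` T')%fset by apply/fsubsetP => f; rewrite !inE => /andP[].
have BT' : (B `<=` T')%fset by exact: fsubsetDl.
have small C : (C `<=` T')%fset -> (#|` C| < k)%N.
  by move=> /fsubset_leq_card /leq_ltn_trans; apply.
have toA y : connected_in [set` T'] v y -> connected_in [set` A] v y.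
  exact: connected_in_component.
have toB y : connected_in [set` T'] v' y -> connected_in [set` B] v' y.
  exact: connected_in_other_component.
have : (n <= cnt A v)%N || (n <= cnt B v')%N.
  have : (cnt T v <= cnt A v + cnt B v')%N.
    rewrite -[X in (_ <= X)%N]count_predUI; apply: leq_trans (leq_addr _ _).
    apply: sub_count => y /asboolP/dich[/toA|/toB] h /=.
      by apply/orP; left; apply/asboolP.
    by apply/orP; right; apply/asboolP.
  by move: le; lia.
have AB : [set` A] `<=` [set` (w `\` B)%fset].
  move=> f /= fA; rewrite in_fsetD [f \in B]in_fsetD fA/=.
  by apply: (fsubsetP T'w); exact: (fsubsetP AT').
have BA : [set` B] `<=` [set` (w `\` A)%fset].
  move=> f /=; rewrite !in_fsetD => /andP[-> /andP[_ fT]] /=; exact: (fsubsetP Tw _ fT).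
case/orP => nc.
  apply: (IH v A (small _ AT')); split=> //; first exact: fsubset_trans T'w.
    exact: uvC.
  move=> y /cov[/uC|/dich[/toA|/toB h]]; [left; auto|by right|left].
  apply: connected_in_trans (uvC _ AT') _.
  apply: connected_in_trans (connected_in_adj (eC _ AT')) _.
  exact: connected_in_le h.
apply: (IH v' B (small _ BT')); split=> //; first exact: fsubset_trans T'w.
  exact: connected_in_step (uvC _ BT') (eC _ BT').
move=> y /cov[/uC|/dich[/toA h|/toB]]; [left; auto|left|by right].
apply: connected_in_trans (uvC _ BT') _; exact: connected_in_le h.
Qed.

Lemma split_marked : (forall y, y \in s -> connected_in [set` w] u y) ->
  (3 * n <= size s)%N ->
  exists v T, [/\ (T `<=` w)%fset, connected_in [set` (w `\` T)%fset] u v,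
   (n <= count (fun y => `[< connected_in [set` (w `\` T)%fset] u y >]) s)%N &
   (n <= count (fun y => `[< connected_in [set` T] v y >]) s)%N].
Proof.
move=> ws ns.
have all_w : cnt w u = size s.
  by apply/eqP; rewrite -all_count; apply/allP => y /ws /asboolP.
have [|v [T [[Tw uv cov cn] lt]]] := @valid_balanced u w.
  split=> //; first exact: connected_in_refl.
    by move=> y /ws; right.
  by rewrite all_w; lia.
exists v, T; split=> //.
(* At least [3 n] marked vertices are covered and [T] reaches fewer than [2 n] of them, which leaves
   [n] for the complement. *)
have := count_predUI (fun y => `[< connected_in [set` (w `\` T)%fset] u y >])
  (fun y => `[< connected_in [set` T] v y >]) s.
rewrite -/(cnt T v); have /eqP -> : count (predU (fun y =>
    `[< connected_in [set` (w `\` T)%fset] u y >])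
  (fun y => `[< connected_in [set` T] v y >])) s == size s; last by lia.
rewrite -all_count; apply/allP => y /cov[h|h] /=; apply/orP; [left|right]; exact/asboolP.
Qed.

End Split.

(** Finitely many open edges suffice for the event, and these can be cut. The connection from [u] to
    the cut vertex [v] is recorded because one use of the lemma sums over [v]. *)
Lemma reach_ge_split V n u w : (0 < n)%N -> reach_ge V (3 * n) u w ->
  exists v, disjointly (fun A B => (connected_in A u v /\ reach_ge V n u A) /\
                                   reach_ge V n v B) w.
Proof.
move=> n0 /reach_ge_finite[W Ww [s [us sn h]]].
have [||v [T [TW uv c1 c2]]] := @split_marked W u s n us n0.
- by move=> y /h[].
- by rewrite sn.
have sV y : y \in s -> V y by move=> /h[].
exists v, [set` (W `\` T)%fset], [set` T]; split.
- by move=> e /=; rewrite inE => /andP[_ /Ww].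
- by move=> e /= /(fsubsetP TW) /Ww.
- by apply/seteqP; split=> // e [/=]; rewrite inE => /andP[/negP].
- by split; [split=> //|]; exact: reach_ge_count us sV _.
Qed.

End Connectivity.

(** * Increasing events of the percolation measure *)

Section Percolation.
Variables (R : realType) (d : nat) (mu : probability (config d) R).
Hypothesis indep : mutually_independent mu (@open_edge d).
Implicit Types (Q : set (edge d) -> Prop) (l : seq (edge d)) (A : {fset edge d}).

(** For an increasing [Q], this makes the event an increasing limit of cylinder events, hence
    measurable. *)
Definition finitary Q := forall w, Q w ->
  exists2 T : {fset edge d}, [set` T] `<=` w & Q [set` T].

Definition event Q : set (config d) := [set w | Q w].

Definition restrict l (w : set (edge d)) : set (edge d) := [set e | e \in l /\ w e].

Definition pr Q : R := fine (mu (event Q)).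

Definition edge_weight (e : edge d) : R := fine (mu (open_edge e)).

Lemma measurable_open_edge e : measurable (open_edge e : set (config d)).
Proof. by apply: sub_sigma_algebra; exists e. Qed.

Lemma restrict_cons e l w :
  restrict (e :: l) w = if `[< w e >] then e |` restrict l w else restrict l w.
Proof.
case: asboolP => we; apply/seteqP; split=> f; rewrite /restrict /= inE.
- by move=> [/predU1P[->|fl] wf]; [left|right].
- by move=> [->|[-> ?]]; rewrite ?eqxx ?orbT.
- by move=> [/predU1P[fe|//] wf]; case: we; rewrite -fe.
- by move=> [-> ?]; rewrite orbT.
Qed.

Lemma event_restrict_cons e l Q :
  event (fun w => Q (restrict (e :: l) w)) =
  (event (fun w => Q (e |` restrict l w)) `&` open_edge e) `|`
  (event (fun w => Q (restrict l w)) `\` open_edge e).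
Proof.
apply/seteqP; split=> w; rewrite /event /= restrict_cons.
  by case: asboolP => we Qw; [left|right].
by case: asboolP => we [[]|[]].
Qed.

Lemma measurable_restrict l Q : measurable (event (fun w => Q (restrict l w))).
Proof.
elim: l Q => [|e l IH] Q.
  rewrite (_ : event _ = [set w | Q set0]); last first.
    by apply/seteqP; split=> w; rewrite /event/= (_ : restrict [::] w = set0)//;
       apply/seteqP; split=> // e [].
  by have [h|h] := pselect (Q set0); [rewrite (_ : mkset _ = setT)|rewrite (_ : mkset _ = set0)];
    rewrite //; apply/seteqP; split.
rewrite event_restrict_cons; apply: measurableU.
  by apply: measurableI; [exact: (IH (fun S => Q (e |` S)))|exact: measurable_open_edge].
by apply: measurableD; [exact: IH|exact: measurable_open_edge].
Qed.

Lemma muE (X : set (config d)) : measurable X -> mu X = (fine (mu X))%:E.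
Proof. by move=> mX; rewrite fineK// fin_num_measure. Qed.

Lemma edge_weight01 e : 0 <= edge_weight e <= 1.
Proof.
rewrite fine_ge0//= -lee_fin -muE; last exact: measurable_open_edge.
by apply: probability_le1; exact: measurable_open_edge.
Qed.

Lemma measurable_open_edges A :
  measurable (\bigcap_(i in [set` A]) (open_edge i : set (config d))).
Proof.
apply: fin_bigcap_measurable => // e _; exact: measurable_open_edge.
Qed.

(** Independence is assumed for open edges only; closed edges are reached by subtraction. The set
    [A] of edges already required to be open is carried along for the induction on [l]. *)
Lemma measure_restrict l : uniq l -> forall A, (forall e, e \in l -> e \notin A) ->
  forall Q, mu ((\bigcap_(i in [set` A]) open_edge i) `&`
                event (fun w => Q (restrict l w))) =
    ((\prod_(e <- A) edge_weight e) * prob edge_weight l Q)%:E.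
Proof.
have prodE A : mu (\bigcap_(i in [set` A]) open_edge i) =
    (\prod_(e <- A) edge_weight e)%:E.
  rewrite indep -prodEFin; apply: eq_bigr => e _.
  by apply: muE; exact: measurable_open_edge.
elim: l => [_ A _ Q|e l IH /= /andP[el ul] A eA Q] /=.
  have r0 w : restrict [::] w = set0 by apply/seteqP; split=> // ? [].
  case: asboolP => Q0.
    rewrite mulr1 -prodE; congr (mu _); apply/seteqP; split=> w; first by case.
    by move=> ?; split=> //; rewrite /event/= r0.
  rewrite mulr0 (_ : _ `&` _ = set0) ?measure0//; apply/seteqP; split=> // w [_].
  by rewrite /event/= r0.
have nA : e \notin A by apply: eA; rewrite mem_head.
have lA f : f \in l -> f \notin A by move=> fl; apply: eA; rewrite inE fl orbT.
have leA f : f \in l -> f \notin (e |` A)%fset.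
  move=> fl; rewrite in_fset1U negb_or lA// andbT.
  by apply: contraNneq el => <-.
pose X Q : set (config d) := (\bigcap_(i in [set` A]) open_edge i) `&` event (fun w => Q (restrict l w)).
have mX Q' : measurable (X Q').
  by apply: measurableI; [exact: measurable_open_edges|exact: measurable_restrict].
have mo : measurable (open_edge e : set (config d)) := measurable_open_edge e.
have capE : \bigcap_(i in [set` (e |` A)%fset]) open_edge i =
    (\bigcap_(i in [set` A]) open_edge i) `&` open_edge e.
  apply/seteqP; split=> w.
    by move=> h; split=> [i iA|]; apply: h; rewrite /= in_fset1U ?eqxx// iA orbT.
  by move=> [h we] i /=; rewrite in_fset1U => /predU1P[->|/h].
have XoE Q' : mu (X Q' `&` open_edge e) =
    (edge_weight e * (\prod_(e <- A) edge_weight e) * prob edge_weight l Q')%:E.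
  by rewrite setIAC -capE (IH ul _ leA) big_fsetU1.
have XE Q' : mu (X Q') = ((\prod_(e <- A) edge_weight e) * prob edge_weight l Q')%:E.
  exact: IH.
have XD Q' : mu (X Q' `\` open_edge e) = ((\prod_(e <- A) edge_weight e) *
    ((1 - edge_weight e) * prob edge_weight l Q'))%:E.
  have muX : (mu (X Q') < +oo)%E by rewrite XE ltry.
  have := measureD (mX Q') mo muX; rewrite [X in _ = (X - _)%E]XE.
  by rewrite [X in _ = (_ - X)%E]XoE -EFinB => ->; congr (_%:E); ring.
have -> : mu ((\bigcap_(i in [set` A]) open_edge i) `&`
      event (fun w => Q (restrict (e :: l) w))) =
    (mu (X (fun S => Q (e |` S)) `&` open_edge e) + mu (X Q `\` open_edge e))%E.
  rewrite event_restrict_cons setIUr setIDA setIA; apply: measureU.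
  - by apply: measurableI => //; exact: (mX (fun S => Q (e |` S))).
  - by apply: measurableD => //; exact: mX.
  - by apply/seteqP; split=> // w [[_ ?] [_ ?]].
by rewrite XD XoE -EFinD; congr (_%:E); ring.
Qed.

Lemma prob_restrict l Q : uniq l ->
  prob edge_weight l Q = pr (fun w => Q (restrict l w)).
Proof.
move=> ul; have /(_ fset0) := measure_restrict ul; rewrite /pr.
have -> : \bigcap_(i in [set` (fset0 : {fset edge d})]) (@open_edge d i) = setT.
  by apply/seteqP; split=> // w _ i /=; rewrite in_fset0.
move=> /(_ (fun e _ => negbT (in_fset0 e)) Q); rewrite setTI => ->.
by rewrite big_seq_fset0 mul1r.
Qed.

(** Finite lists that exhaust the countable set of edges; codes of no edge are skipped. *)
Definition first_edges (n : nat) : seq (edge d) := pmap choice.pickle_inv (iota 0 n).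

Lemma first_edges_uniq n : uniq (first_edges n).
Proof. by apply: (pmap_uniq pickle_invK); exact: iota_uniq. Qed.

Lemma mem_first_edges n (e : edge d) : (choice.pickle e < n)%N -> e \in first_edges n.
Proof.
move=> en; rewrite mem_pmap; apply/mapP; exists (choice.pickle e).
  by rewrite mem_iota.
by rewrite pickleK_inv.
Qed.

Lemma restrict_first_edges n m w : (n <= m)%N ->
  restrict (first_edges n) w `<=` restrict (first_edges m) w.
Proof.
move=> nm e [+ we]; split=> //; move: a; rewrite !mem_pmap => /mapP[k + ->].
by rewrite mem_iota /= => kn; apply: map_f; rewrite mem_iota /= (leq_trans kn).
Qed.

(** * Increasing finitary events as limits of cylinder events *)

Section Event.
Variable Q : set (edge d) -> Prop.
Hypotheses (upQ : increasing Q) (finQ : finitary Q).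

Lemma event_bigcup :
  event Q = \bigcup_n event (fun w => Q (restrict (first_edges n) w)).
Proof.
apply/seteqP; split=> w; last by move=> [n _]; apply: upQ => e [].
move=> /finQ[T Tw QT]; exists (\max_(e <- T) (choice.pickle e).+1)%N => //.
apply: upQ QT => e /= eT; split; last exact: Tw.
by apply: mem_first_edges; rewrite (big_fsetD1 e)//= leq_maxl.
Qed.

Lemma measurable_event : measurable (event Q).
Proof. by rewrite event_bigcup; apply: bigcup_measurable => n _; exact: measurable_restrict. Qed.

Lemma prE : mu (event Q) = (pr Q)%:E.
Proof. by apply: muE; exact: measurable_event. Qed.

Lemma le_pr_prob l : uniq l -> prob edge_weight l Q <= pr Q.
Proof.
move=> ul; rewrite (prob_restrict _ ul) -lee_fin -prE -muE; last exact: measurable_restrict.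
apply: le_measure; rewrite ?inE; [exact: measurable_restrict|exact: measurable_event|].
by move=> w; apply: upQ => e [].
Qed.

(** Continuity from below along [first_edges]. With [le_pr_prob] it makes [pr Q] the supremum of the
    finite probabilities, through which finite inequalities are transferred. *)
Lemma pr_le_prob (c : R) :
  (forall l, uniq l -> prob edge_weight l Q <= c) -> pr Q <= c.
Proof.
move=> h; rewrite -lee_fin -prE event_bigcup.
have ndF : {homo (fun n => event (fun w => Q (restrict (first_edges n) w))) :
    n m / (n <= m)%N >-> (n <= m)%O}.
  move=> n m nm; apply/subsetPset => w; apply: upQ; exact: restrict_first_edges.
have mF n : measurable (event (fun w => Q (restrict (first_edges n) w))).
  exact: measurable_restrict.
have mU := bigcup_measurable (fun n (_ : True) => mF n).
have := nondecreasing_cvg_mu (mu := mu) mF mU ndF.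
move=> /cvg_lim <-//; apply: lime_le.
  by apply/cvg_ex; eexists; exact: (nondecreasing_cvg_mu (mu := mu) mF mU ndF).
apply: nearW => n /=; rewrite muE// lee_fin -/(pr _) -prob_restrict ?first_edges_uniq//.
exact/h/first_edges_uniq.
Qed.

End Event.

Lemma pr_ge0 Q : 0 <= pr Q. Proof. exact: fine_ge0. Qed.

End Percolation.

(** * The number of events that occur: tail sums and Markov's inequality *)

Section Counting.
Variables (R : realType) (dsp : measure_display) (T : measurableType dsp).
Variables (P : probability T R) (I : eqType) (E : I -> set T).
Hypothesis mE : forall i, measurable (E i).

Definition at_least (s : seq I) (n : nat) : set T :=
  [set w | (n <= count (fun i => `[< E i w >]) s)%N].

Lemma at_least0 s : at_least s 0 = setT.
Proof. by apply/seteqP; split. Qed.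

Lemma at_least_cons i s n :
  at_least (i :: s) n.+1 = at_least s n.+1 `|` (E i `&` (at_least s n `\` at_least s n.+1)).
Proof.
apply/seteqP; split=> w; rewrite /at_least /=; case: asboolP => Ei /=.
- by rewrite add1n ltnS => h; case: (ltnP n (count (fun i => `[< E i w >]) s)) => h';
    [left|right; split=> //; split=> //; apply/negP; rewrite -leqNgt].
- by rewrite add0n; left.
- by rewrite add1n ltnS => -[/ltnW//|[_ []]].
- by rewrite add0n => -[|[]].
Qed.

Lemma at_leastW s n m : (n <= m)%N -> at_least s m `<=` at_least s n.
Proof. by move=> nm w; exact: leq_trans. Qed.

Lemma measurable_at_least s n : measurable (at_least s n).
Proof.
elim: s n => [|i s IH] [|n]; rewrite ?at_least0//.
  by rewrite (_ : at_least _ _ = set0)//; apply/seteqP; split.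
by rewrite at_least_cons; apply: measurableU => //; apply: measurableI => //; exact: measurableD.
Qed.

(** The mean of the number N of occurring events is the sum of its tail. A further event [E i]
    raises the tail at [n.+1] by the probability of [E i] with N = n, which is [g n - g n.+1]; these
    increments telescope to the probability of [E i]. *)
Lemma sum_measure_at_least s :
  \sum_(i <- s) fine (P (E i)) = \sum_(n < size s) fine (P (at_least s n.+1)).
Proof.
have fP X : measurable X -> P X = (fine (P X))%:E.
  by move=> mX; rewrite fineK// fin_num_measure.
elim: s => [|i s IH]; first by rewrite big_nil big_ord0.
pose g n := fine (P (E i `&` at_least s n)).
have mA := measurable_at_least.
have mEA n : measurable (E i `&` at_least s n) by exact: measurableI.
have step n : fine (P (at_least (i :: s) n.+1)) =
    fine (P (at_least s n.+1)) + (g n - g n.+1).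
  have -> : P (at_least (i :: s) n.+1) = (P (at_least s n.+1) +
      P ((E i `&` at_least s n) `\` (E i `&` at_least s n.+1)))%E.
    rewrite at_least_cons -measureU//.
    - congr (P (_ `|` _)); apply/seteqP; split=> w.
        by move=> [Ew [h h']]; split=> // -[].
      by move=> [[Ew h] h']; split=> //; split=> // h''; exact: h'.
    - exact: measurableD.
    - by apply/seteqP; split=> // w [h [[? _] []]].
  have Pfin : (P (E i `&` at_least s n) < +oo)%E by rewrite fP// ltry.
  have -> : P ((E i `&` at_least s n) `\` (E i `&` at_least s n.+1)) =
      (g n - g n.+1)%:E.
    have := measureD (mEA n) (mEA n.+1) Pfin.
    have -> : (E i `&` at_least s n) `&` (E i `&` at_least s n.+1) = E i `&` at_least s n.+1.
      apply/seteqP; split=> w [// Ew h]; split; split=> //.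
      exact: (at_leastW (leqnSn n)).
    rewrite [X in _ = (X - _)%E](fP _ (mEA n)) [X in _ = (_ - X)%E](fP _ (mEA n.+1)).
    exact.
  by rewrite fP.
rewrite big_cons IH [size (_ :: _)]/=.
have -> : \sum_(n < (size s).+1) fine (P (at_least (i :: s) n.+1)) =
    \sum_(n < (size s).+1) (fine (P (at_least s n.+1)) + (g n - g n.+1)).
  by apply: eq_bigr => n _; exact: step.
rewrite big_split /=.
rewrite big_ord_recr /= (_ : at_least s (size s).+1 = set0); last first.
  apply/seteqP; split=> // w; rewrite /at_least /= => h.
  by have := leq_trans h (count_size _ _); rewrite ltnn.
rewrite measure0 addr0 addrC; congr (_ + _).
have := telescope_sumr (fun k => - g k) (leq0n (size s).+1).
rewrite big_mkord (eq_bigr (fun k : 'I_(size s).+1 => g k - g k.+1)); last first.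
  by move=> k _; rewrite opprK addrC.
move=> ->; rewrite opprK {1}/g.
rewrite (_ : E i `&` at_least s (size s).+1 = set0); last first.
  apply/seteqP; split=> // w [_]; rewrite /at_least /= => h.
  by have := leq_trans h (count_size _ _); rewrite ltnn.
by rewrite measure0 oppr0 add0r /g at_least0 setIT.
Qed.

(** The first [n] terms of the tail sum are each at least the [n]-th one. *)
Lemma markov_at_least s n :
  n%:R * fine (P (at_least s n)) <= \sum_(i <- s) fine (P (E i)).
Proof.
have fP X : measurable X -> P X = (fine (P X))%:E.
  by move=> mX; rewrite fineK// fin_num_measure.
have [sn|ns] := ltnP (size s) n.
  rewrite (_ : at_least s n = set0); last first.
    apply/seteqP; split=> // w; rewrite /at_least /= => h.
    by have := leq_trans h (count_size _ _); rewrite leqNgt sn.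
  by rewrite measure0 mulr0; apply: sumr_ge0 => i _; exact: fine_ge0.
rewrite sum_measure_at_least -(subnKC ns) big_split_ord /=.
apply: ler_wpDr; first by apply: sumr_ge0 => i _; exact: fine_ge0.
rewrite -[X in X%:R * _](card_ord n) mulr_natl -sumr_const.
apply: ler_sum => k _; rewrite -lee_fin -!fP; try exact: measurable_at_least.
apply: le_measure; rewrite ?inE; try exact: measurable_at_least.
exact: at_leastW.
Qed.

End Counting.

(** * Closure properties of increasing and finitary events *)

Section Finitary.
Variable d : nat.
Implicit Types (Q : set (edge d) -> Prop).

Lemma increasing_connected_in (x y : lattice d) : increasing (fun w => connected_in w x y).
Proof. by move=> w w' ww'; exact: connected_in_le. Qed.

Lemma finitary_connected_in (x y : lattice d) : finitary (fun w => connected_in w x y).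
Proof. by move=> w; exact: connected_in_finite. Qed.

Lemma increasing_reach_ge V n (x : lattice d) : increasing (reach_ge V n x).
Proof. by move=> w w'; exact: reach_ge_le. Qed.

Lemma finitary_reach_ge V n (x : lattice d) : finitary (reach_ge V n x).
Proof. by move=> w; exact: reach_ge_finite. Qed.

Lemma increasingI Q Q' : increasing Q -> increasing Q' ->
  increasing (fun w => Q w /\ Q' w).
Proof. by move=> h h' A B AB [/(h _ _ AB) ? /(h' _ _ AB)]. Qed.

Lemma finitaryI Q Q' : increasing Q -> increasing Q' -> finitary Q -> finitary Q' ->
  finitary (fun w => Q w /\ Q' w).
Proof.
move=> u u' f f' w [/f[T Tw QT] /f'[T' Tw' QT']].
exists (T `|` T')%fset; first by move=> e /= /fsetUP[/Tw|/Tw'].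
by split; [apply: u QT|apply: u' QT'] => e /= eT; rewrite inE eT ?orbT.
Qed.

Lemma increasing_exists (J : Type) (Q : J -> set (edge d) -> Prop) :
  (forall j, increasing (Q j)) -> increasing (fun w => exists j, Q j w).
Proof. by move=> h A B AB [j /(h _ _ _ AB)]; exists j. Qed.

Lemma finitary_exists (J : Type) (Q : J -> set (edge d) -> Prop) :
  (forall j, finitary (Q j)) -> finitary (fun w => exists j, Q j w).
Proof. by move=> h w [j /h[T Tw QT]]; exists T => //; exists j. Qed.

Lemma increasing_disjointly D : increasing (@disjointly (edge d) D).
Proof.
move=> A B AB [S [T [SA TA ST DST]]]; exists S, T; split=> //.
  exact: subset_trans AB.
exact: subset_trans AB.
Qed.

Lemma finitary_disjointly Q Q' : finitary Q -> finitary Q' ->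
  finitary (disjointly (fun A B => Q A /\ Q' B)).
Proof.
move=> f f' w [S [T [Sw Tw ST0 [/f[S' SS' QS] /f'[T' TT' QT]]]]].
exists (S' `|` T')%fset; first by move=> e /= /fsetUP[/SS'/Sw|/TT'/Tw].
exists [set` S'], [set` T']; split=> //.
- by move=> e /= eS; rewrite inE eS.
- by move=> e /= eT; rewrite inE eT orbT.
- by apply/seteqP; split=> // e [/SS' Se /TT' Te]; rewrite -ST0.
Qed.

End Finitary.

(** * Inequalities for cluster sizes *)

Section Translation.
Variable d : nat.

Fact shift_edge_subproof (a : lattice d) (e : edge d) :
  #|` [fset (a + x)%R | x in val e]%fset| == 2.
Proof. by rewrite card_imfset ?(valP e)//; exact: addrI. Qed.

Definition shift_edge (a : lattice d) (e : edge d) : edge d :=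
  exist _ [fset (a + x)%R | x in val e]%fset (shift_edge_subproof a e).

Lemma val_shift_edge a (e : edge d) x y : val e = [fset x; y]%fset ->
  val (shift_edge a e) = [fset (a + x)%R; (a + y)%R]%fset.
Proof.
move=> /= ->; apply/fsetP => z; apply/imfsetP/fset2P => /=.
  by move=> [_ /fset2P[]-> ->]; [left|right].
by move=> [] ->; [exists x|exists y]; rewrite // !inE eqxx ?orbT.
Qed.

Lemma edgeP (e : edge d) : exists x y, val e = [fset x; y]%fset.
Proof.
have [x xe] : exists x, x \in val e.
  by apply/fset0Pn; rewrite -cardfs_gt0 (eqP (valP e)).
have := valP e; rewrite (cardfsD1 x) xe => /cardfs1P[y ey].
by exists x, y; rewrite -ey fsetD1K.
Qed.

Lemma shift_edge_inj a : injective (shift_edge a).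
Proof.
move=> e f /(congr1 val) /= ef; apply: val_inj; apply/fsetP => x.
have h (g : edge d) : (x \in val g) = (a + x \in [fset (a + x)%R | x in val g]%fset).
  by rewrite mem_imfset//; exact: addrI.
by rewrite !h ef.
Qed.

Lemma connected_in_shift a (w : set (edge d)) x y : connected_in w x y ->
  connected_in (shift_edge a @` w) (a + x) (a + y).
Proof.
move: y; apply: connected_in_ind => [|y z _ IH [e eyz we]].
  exact: connected_in_refl.
apply: connected_in_step IH _; exists (shift_edge a e); last by exists e.
exact: val_shift_edge.
Qed.

Lemma reach_ge_shift a n x (w : set (edge d)) :
  reach_ge setT n x w -> reach_ge setT n (a + x) (shift_edge a @` w).
Proof.
move=> [s [us sn h]]; exists (map (+%R a) s); split.
- by rewrite map_inj_uniq//; exact: addrI.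
- by rewrite size_map.
- by move=> _ /mapP[y /h[_ xy] ->]; split=> //; exact: connected_in_shift.
Qed.

End Translation.

(** * BK, translation invariance and moment bounds for the percolation measure *)

Section Inequalities.
Variables (R : realType) (d : nat) (mu : probability (config d) R).
Hypothesis indep : mutually_independent mu (@open_edge d).
Implicit Types (Q : set (edge d) -> Prop) (V : set (lattice d)).

Lemma le_pr Q Q' : increasing Q -> finitary Q -> increasing Q' -> finitary Q' ->
  (forall w, Q w -> Q' w) -> pr mu Q <= pr mu Q'.
Proof.
move=> uQ fQ uQ' fQ' QQ'; rewrite -lee_fin -!prE//.
by apply: le_measure; rewrite ?inE//; exact: measurable_event.
Qed.

Lemma pr_le1 Q : increasing Q -> finitary Q -> pr mu Q <= 1.
Proof.
by move=> uQ fQ; rewrite -lee_fin -prE//; apply: probability_le1; exact: measurable_event.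
Qed.

Lemma pr_BK Q Q' : increasing Q -> finitary Q -> increasing Q' -> finitary Q' ->
  pr mu (disjointly (fun A B => Q A /\ Q' B)) <= pr mu Q * pr mu Q'.
Proof.
move=> uQ fQ uQ' fQ'; apply: pr_le_prob => //.
- exact: increasing_disjointly.
- exact: finitary_disjointly.
move=> l ul; apply: le_trans (prob_BK (edge_weight01 mu) l uQ uQ') _.
have prob0 Q0 : 0 <= prob (edge_weight mu) l Q0 by rewrite prob_restrict// pr_ge0.
by apply: ler_pM => //; exact: le_pr_prob.
Qed.

(** Only the counted vertices have to lie in [V]; the base point and the connecting paths may leave
    it. *)
Definition max_reach V n (w : set (edge d)) := exists x, reach_ge V n x w.

Lemma increasing_max_reach V n : increasing (max_reach V n).
Proof. by apply: increasing_exists => x; exact: increasing_reach_ge. Qed.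

Lemma finitary_max_reach V n : finitary (max_reach V n).
Proof. by apply: finitary_exists => x; exact: finitary_reach_ge. Qed.

(** Each of the two edge-disjoint pieces is again a witness at level [n], so BK gives the square. *)
Lemma pr_max_reach V n : (0 < n)%N ->
  pr mu (max_reach V (3 * n)) <= pr mu (max_reach V n) ^+ 2.
Proof.
move=> n0; have u := @increasing_max_reach V n; have f := @finitary_max_reach V n.
rewrite expr2; apply: le_trans (pr_BK u f u f).
apply: le_pr; [exact: increasing_max_reach|exact: finitary_max_reach|
  exact: increasing_disjointly|exact: finitary_disjointly|].
move=> w [x /(reach_ge_split n0)[v [S [T [Sw Tw ST0 [[_ xS] vT]]]]]].
by exists S, T; split=> //; split; [exists x|exists v].
Qed.

Variables (J : lattice d -> R) (beta : R).
Hypothesis law : percolation_law J beta mu.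

Lemma edge_weight_shift a e : edge_weight mu (shift_edge a e) = edge_weight mu e.
Proof.
have [x [y exy]] := edgeP e; have [h _] := law.
rewrite /edge_weight (h _ _ _ exy) (h _ _ _ (val_shift_edge a exy)).
by rewrite opprD addrACA subrr add0r.
Qed.

Definition cluster_tail n := pr mu (reach_ge setT n (0 : lattice d)).

Local Notation q := cluster_tail.

(** One inequality for every shift suffices, since shifting back by the opposite vector gives the
    converse. *)
Lemma pr_reach_ge_shift n x : pr mu (reach_ge setT n x) = q n.
Proof.
suff le a y : pr mu (reach_ge setT n y) <= pr mu (reach_ge setT n (a + y)).
  apply/eqP; rewrite eq_le; apply/andP; split.
    by have := le (- x) x; rewrite addNr.
  by have := le x 0; rewrite addr0.
apply: pr_le_prob => //; [exact: increasing_reach_ge|exact: finitary_reach_ge|].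
move=> l ul; apply: le_trans (le_pr_prob indep (@increasing_reach_ge _ _ _ _)
  (@finitary_reach_ge _ _ _ _) (l := map (shift_edge a) l) _); last first.
  by rewrite map_inj_uniq//; exact: shift_edge_inj.
rewrite prob_map; last exact: edge_weight_shift.
by apply: (le_prob (edge_weight01 mu)) => A; exact: reach_ge_shift.
Qed.

Lemma pr_reach_geW n m : (n <= m)%N -> q m <= q n.
Proof.
move=> nm; apply: le_pr; try exact: increasing_reach_ge; try exact: finitary_reach_ge.
by move=> w; exact: reach_geW.
Qed.

Section FiniteVolume.
Variable s : seq (lattice d).
Hypothesis us : uniq s.

(** A cluster with [n] vertices in [s] provides [n] vertices of [s] whose own clusters have size at
    least [n]; Markov's inequality applies to the number of such vertices. *)
Lemma pr_max_reach_markov n :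
  n%:R * pr mu (max_reach [set` s] n) <= (size s)%:R * q n.
Proof.
have mE (y : lattice d) : measurable (event (reach_ge setT n y)).
  apply: measurable_event; [exact: increasing_reach_ge|exact: finitary_reach_ge].
have := markov_at_least mu mE s n; rewrite (eq_bigr (fun=> q n)); last first.
  by move=> y _; exact: pr_reach_ge_shift.
rewrite big_const_seq count_predT iter_addr_0 -[q n *+ _]mulr_natl; apply: le_trans.
apply: ler_wpM2l => //; rewrite -lee_fin -prE; [|exact: increasing_max_reach|exact: finitary_max_reach].
rewrite -muE; last exact: measurable_at_least.
apply: le_measure; rewrite ?inE; [|exact: measurable_at_least|].
  apply: measurable_event; [exact: increasing_max_reach|exact: finitary_max_reach].
move=> w [x [t [ut tn h]]]; rewrite /at_least /= -tn -size_filter.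
apply: uniq_leq_size => // y yt; have [ys xy] := h y yt.
rewrite mem_filter; apply/andP; split=> //; apply/asboolP; exists t.
split=> // z zt; split=> //; apply: connected_in_trans (connected_in_sym xy) _.
by have [] := h z zt.
Qed.

(* Summing [P(0 <-> y, Q)] over [y] in [s] gives the mean of the number of
   vertices of [s] in the cluster of [0] on [Q], hence the sum of its tail. *)
Lemma sum_pr_connected Q (f : nat -> R) : increasing Q -> finitary Q ->
  (forall n, (0 < n)%N -> pr mu (fun w => reach_ge [set` s] n 0 w /\ Q w) <= f n) ->
  \sum_(y <- s) pr mu (fun w => connected_in w 0 y /\ Q w) <=
  \sum_(n < size s) f n.+1.
Proof.
move=> uQ fQ hf.
have mE y : measurable (event (fun w => connected_in w 0 y /\ Q w)).
  apply: measurable_event.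
    by apply: increasingI => //; exact: increasing_connected_in.
  apply: finitaryI => //; [exact: increasing_connected_in|exact: finitary_connected_in].
rewrite (sum_measure_at_least mu mE s); apply: ler_sum => n _.
apply: le_trans (hf _ (ltn0Sn n)); set Q' := fun w => _ /\ Q w.
have uQ' : increasing Q' by apply: increasingI => //; exact: increasing_reach_ge.
have fQ' : finitary Q'.
  apply: finitaryI => //; [exact: increasing_reach_ge|exact: finitary_reach_ge].
rewrite -lee_fin -[leRHS]prE// -muE; last exact: measurable_at_least.
apply: le_measure; rewrite ?inE; [exact: measurable_at_least|exact: measurable_event|].
move=> w; rewrite /at_least /= => h; split.
  apply: (@reach_ge_count _ _ _ _ _ s) => //; apply: leq_trans h _.
  by apply: sub_count => y /asboolP[h _]; apply/asboolP.
have : has (fun i => `[< event (fun w => connected_in w 0 i /\ Q w) w >]) s.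
  by rewrite has_count; exact: leq_trans h.
by move=> /hasP[y _ /asboolP[]].
Qed.

(** The tail of the number of vertices of [s] joined to 0 is bounded by [q] below [L] and by the
    probability of [max_reach] at [L] from there on, for at most [size s] terms. *)
Lemma sum_pr_two_point (L : nat) :
  \sum_(y <- s) pr mu (fun w => connected_in w 0 y) <=
  \sum_(1 <= n < L) q n + (size s)%:R * pr mu (max_reach [set` s] L).
Proof.
have e y : pr mu (fun w => connected_in w 0 y) =
    pr mu (fun w => connected_in w 0 y /\ True).
  by congr (pr mu _); apply/funext => w; apply/propext; split=> [|[]].
rewrite (eq_bigr _ (fun y _ => e y)).
pose m n := if (n < L)%N then q n else pr mu (max_reach [set` s] L).
have m0 n : 0 <= m n by rewrite /m; case: ifP => _; exact: pr_ge0.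
apply: le_trans (@sum_pr_connected (fun=> True) m _ _ _) _ => //.
- by move=> w _; exists fset0 => // ?; rewrite /= in_fset0.
- have t : finitary (fun=> True : Prop).
    by move=> ? w _; exists fset0 => // ?; rewrite /= in_fset0.
  move=> n n0; rewrite /m; case: ltnP => nL; apply: le_pr.
  + by apply: increasingI => //; exact: increasing_reach_ge.
  + by apply: finitaryI => //; [exact: increasing_reach_ge|exact: finitary_reach_ge].
  + exact: increasing_reach_ge.
  + exact: finitary_reach_ge.
  + by move=> w [h _]; exact: reach_ge_sub h.
  + by apply: increasingI => //; exact: increasing_reach_ge.
  + by apply: finitaryI => //; [exact: increasing_reach_ge|exact: finitary_reach_ge].
  + exact: increasing_max_reach.
  + exact: finitary_max_reach.
  + by move=> w [h _]; exists 0; exact: reach_geW h.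
have mE n : m n <= (if (n < L)%N then q n else 0) + pr mu (max_reach [set` s] L).
  by rewrite /m; case: ifP => _; rewrite ?add0r// lerDl pr_ge0.
apply: (@le_trans _ _ (\sum_(n < size s)
    ((if (n.+1 < L)%N then q n.+1 else 0) + pr mu (max_reach [set` s] L)))).
  by apply: ler_sum => n _; exact: mE.
rewrite big_split /= sumr_const card_ord mulr_natl lerD2r.
rewrite big_add1 big_mkord.
have -> : \sum_(i < L.-1) q i.+1 =
    \sum_(i < size s + L.-1) if (i.+1 < L)%N then q i.+1 else 0.
  rewrite (big_ord_widen _ (fun i => q i.+1) (leq_addl (size s) L.-1)) big_mkcond.
  by apply: eq_bigr => i _; rewrite (_ : (i.+1 < L)%N = (i < L.-1)%N)//; apply/idP/idP; lia.
rewrite big_split_ord /= ler_wpDr//; apply: sumr_ge0 => i _.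
by case: ifP => // _; exact: pr_ge0.
Qed.

End FiniteVolume.

(* The cluster of [0] is cut at [v], with both [0 <-> v] and the event
   [|K_0| >= n] kept on one side; then BK and a sum over [v]. *)
Lemma pr_reach_ge_split n (c : R) : (0 < n)%N ->
  (forall s, uniq s ->
    \sum_(v <- s) pr mu (fun w => connected_in w 0 v /\ reach_ge setT n 0 w) <= c) ->
  q (3 * n) <= c * q n.
Proof.
move=> n0 hc.
pose Q v := disjointly (fun A B => (connected_in A 0 v /\ reach_ge setT n 0 A) /\
                                   reach_ge setT n v B) : set (edge d) -> Prop.
have u1 v : increasing (fun w : set (edge d) => connected_in w 0 v /\ reach_ge setT n 0 w).
  by apply: increasingI; [exact: increasing_connected_in|exact: increasing_reach_ge].
have f1 v : finitary (fun w : set (edge d) => connected_in w 0 v /\ reach_ge setT n 0 w).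
  by apply: finitaryI; [exact: increasing_connected_in|exact: increasing_reach_ge|
    exact: finitary_connected_in|exact: finitary_reach_ge].
have uQ v : increasing (Q v) by exact: increasing_disjointly.
have fQ v : finitary (Q v) by apply: finitary_disjointly => //; exact: finitary_reach_ge.
have Qle v : pr mu (Q v) <=
    pr mu (fun w => connected_in w 0 v /\ reach_ge setT n 0 w) * q n.
  rewrite -(pr_reach_ge_shift n v); apply: pr_BK => //;
    [exact: increasing_reach_ge|exact: finitary_reach_ge].
(* The union bound over [v] runs along an enumeration of the lattice, with empty events at codes of
   no vertex. *)
pose F k := if choice.pickle_inv k is Some v then event (Q v) else set0.
have mF k : measurable (F k).
  by rewrite /F; case: choice.pickle_inv => // v; exact: measurable_event.
have mq : measurable (event (reach_ge setT (3 * n) (0 : lattice d))).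
  by apply: measurable_event; [exact: increasing_reach_ge|exact: finitary_reach_ge].
rewrite -lee_fin -prE; [|exact: increasing_reach_ge|exact: finitary_reach_ge].
apply: le_trans (measure_sigma_subadditive mu mF mq _) _.
  move=> w /(reach_ge_split n0)[v Qv]; exists (choice.pickle v) => //.
  by rewrite /F pickleK_inv.
apply: lime_le; first by apply: is_cvg_nneseries.
apply: nearW => k.
pose s := pmap choice.pickle_inv (iota 0 k) : seq (lattice d).
have us : uniq s by apply: (pmap_uniq pickle_invK); exact: iota_uniq.
have -> : (\sum_(0 <= i < k) mu (F i) = (\sum_(v <- s) pr mu (Q v))%:E)%E.
  rewrite -sumEFin /s /index_iota subn0; elim: (iota 0 k) => [|i l IH] /=.
    by rewrite !big_nil.
  rewrite big_cons IH /F; case: choice.pickle_inv => [v|] /=.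
    by rewrite big_cons prE.
  by rewrite measure0 add0e.
rewrite lee_fin; apply: le_trans (_ : _ <= (\sum_(v <- s)
    pr mu (fun w => connected_in w 0 v /\ reach_ge setT n 0 w)) * q n) _.
  by rewrite mulr_suml; apply: ler_sum => v _.
by rewrite ler_wpM2r ?pr_ge0// hc.
Qed.

End Inequalities.

(** * From dyadic inequalities to exponents *)

Section Dyadic.
Variable R : realType.
Implicit Types (x y c e : R).

Lemma exp2D x y : 2 `^ (x + y) = 2 `^ x * 2 `^ y :> R.
Proof. by rewrite powRD// pnatr_eq0 implybT. Qed.

Lemma exp2_gt0 x : 0 < 2 `^ x :> R. Proof. exact: powR_gt0. Qed.

Lemma le_exp2 x y : x <= y -> 2 `^ x <= 2 `^ y :> R.
Proof. by apply: ler_powR; rewrite ler1n. Qed.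

Lemma exp2X x n : (2 `^ x) ^+ n = 2 `^ (n%:R * x) :> R.
Proof. by rewrite -powR_mulrn ?powR_ge0// -powRrM mulrC. Qed.

Lemma natrX2 n : (2 ^ n)%:R = 2 `^ n%:R :> R.
Proof. by rewrite natrX powR_mulrn. Qed.

Lemma exp2_gt1 x : 0 < x -> 1 < 2 `^ x :> R.
Proof.
by move=> x0; rewrite /powR pnatr_eq0 /= expR_gt1 mulr_gt0// ln_gt0// ltr1n.
Qed.

Lemma exp2_lt1 x : x < 0 -> 2 `^ x < 1 :> R.
Proof.
by move=> x0; rewrite /powR pnatr_eq0 /= expR_lt1 nmulr_rlt0// ln_gt0// ltr1n.
Qed.

(** If [y < x], the ratio of the two powers grows at least linearly in [j] and exceeds [c]. *)
Lemma le_exponent c x y (j0 : nat) :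
  (forall j : nat, (j0 <= j)%N -> 2 `^ (j%:R * x) <= c * 2 `^ (j%:R * y)) -> x <= y.
Proof.
move=> h; rewrite leNgt; apply/negP => yx; have xy0 : 0 < x - y by rewrite subr_gt0.
have l2 : 0 < ln 2 :> R by rewrite ln_gt0// ltr1n.
have bound j : (j0 <= j)%N -> j%:R * ((x - y) * ln 2) <= c.
  move=> /h; rewrite -ler_pdivrMr ?exp2_gt0// -powRB ?pnatr_eq0 ?implybT//.
  apply: le_trans; rewrite -mulrBr /powR pnatr_eq0 /= -mulrA.
  by apply: le_trans (expR_ge1Dx _); rewrite lerDr.
pose t := (x - y) * ln 2; have t0 : 0 < t by rewrite mulr_gt0.
pose j := maxn j0 (Num.truncn (c / t)).+1.
have := bound j (leq_maxl _ _); rewrite -/t -ler_pdivlMr// leNgt => /negP; apply.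
apply: lt_le_trans (truncnS_gt _) _; by rewrite ler_nat leq_maxr.
Qed.

Variable q : nat -> R.
Hypotheses (q_ge0 : forall n, 0 <= q n) (q_le1 : forall n, q n <= 1).
Hypothesis q_anti : forall n m, (n <= m)%N -> q m <= q n.

(** The block from [2 ^ t] to [2 ^ t.+1] has [2 ^ t] terms, each at most [q (2 ^ t)]. *)
Lemma dyadic_sum i k : (i <= k)%N ->
  \sum_(2 ^ i <= n < 2 ^ k) q n <= \sum_(i <= t < k) 2 `^ t%:R * q (2 ^ t).
Proof.
elim: k => [|k IH].
  by rewrite leqn0 => /eqP->; rewrite !big_geq.
rewrite leq_eqVlt => /predU1P[->|]; first by rewrite !big_geq.
rewrite ltnS => ik; rewrite [leRHS]big_nat_recr//=.
rewrite (@big_cat_nat _ _ _ (2 ^ k))//= ?leq_pexp2l//; apply: lerD; first exact: IH.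
rewrite -natrX2 mulr_natl.
have -> : q (2 ^ k) *+ 2 ^ k = \sum_(2 ^ k <= n < 2 ^ k.+1) q (2 ^ k).
  by rewrite big_const_nat iter_addr_0 expnS mul2n -addnn addnK.
by rewrite big_nat_cond [leRHS]big_nat_cond; apply: ler_sum => n /andP[/andP[kn _] _]; exact: q_anti.
Qed.

Lemma sum_geometric x i k : x != 1 -> (i <= k)%N ->
  \sum_(i <= t < k) x ^+ t = (x ^+ k - x ^+ i) / (x - 1).
Proof.
move=> x1; have x10 : x - 1 != 0 by rewrite subr_eq0.
elim: k => [|k IH]; first by rewrite leqn0 => /eqP->; rewrite big_geq// subrr mul0r.
rewrite leq_eqVlt => /predU1P[->|]; first by rewrite big_geq// subrr mul0r.
by rewrite ltnS => ik; rewrite big_nat_recr//= IH// exprS; field.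
Qed.

(** [kappa] stands for the inverse of [delta]; the power law of [q] is taken along powers of 2. *)
Variable kappa : R.
Hypothesis kappa_gt0 : 0 < kappa.
Hypothesis q_exponent : forall e, 0 < e < kappa -> exists i0 : nat, forall i : nat,
  (i0 <= i)%N -> 2 `^ (i%:R * - (kappa + e)) <= q (2 ^ i) <= 2 `^ (i%:R * - (kappa - e)).

(* If [kappa > 1] then [hq] applies with [c] of order [n ^ (1 - kappa)], and
   [q (4 n) / q n] would decay polynomially. *)
Lemma kappa_le1
  (hq : forall n c, (0 < n)%N ->
    (forall N : nat, (n <= N)%N ->
       n%:R * q n + \sum_(n <= j < N) q j <= c) -> q (4 * n) <= c * q n) :
  kappa <= 1.
Proof.
rewrite leNgt; apply/negP => k1.
(* The final comparison of exponents reads [kappa - 1 <= 3 * e], which a quarter contradicts. *)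
pose e := (kappa - 1) / 4; have e0 : 0 < e by rewrite /e; lra.
have ek : e < kappa by rewrite /e; lra.
pose th := kappa - e; have th1 : 1 < th by rewrite /th /e; lra.
have [|i0 hi] := q_exponent (e := e); first by rewrite e0.
pose rho : R := 2 `^ (1 - th).
have rho1 : rho < 1 by apply: exp2_lt1; lra.
have rho0 : 0 < rho by exact: exp2_gt0.
have term t : (i0 <= t)%N -> 2 `^ t%:R * q (2 ^ t) <= rho ^+ t.
  move=> /hi /andP[_ h]; apply: (@le_trans _ _ (2 `^ t%:R * 2 `^ (t%:R * - th))).
    by rewrite ler_wpM2l ?powR_ge0.
  by rewrite -exp2D /rho exp2X le_eqVlt; apply/orP; left; apply/eqP; congr (_ `^ _); ring.
(* The 1 bounds the term [n * q n], the inverse the geometric sum over the blocks above [n]. *)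
pose C := 1 + (1 - rho)^-1.
have main i : (i0 <= i)%N -> q (2 ^ i.+2) <= C * rho ^+ i * q (2 ^ i).
  move=> ii; rewrite !expnS mulnA; apply: hq; first by rewrite expn_gt0.
  move=> N iN; rewrite natrX2 /C mulrDl mul1r; apply: lerD; first exact: term.
  have [k [ik Nk]] : exists k, (i <= k /\ N <= 2 ^ k)%N.
    exists (i + N)%N; split; first exact: leq_addr.
    by apply: (leq_trans (ltnW (ltn_expl N (isT : 1 < 2)%N))); rewrite leq_pexp2l// leq_addl.
  apply: (@le_trans _ _ (\sum_(2 ^ i <= n < 2 ^ k) q n)).
    by rewrite [leRHS](@big_cat_nat _ _ _ N)//= lerDl; apply: sumr_ge0.
  apply: le_trans (dyadic_sum ik) _.
  apply: (@le_trans _ _ (\sum_(i <= t < k) rho ^+ t)).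
    rewrite big_nat_cond [leRHS]big_nat_cond; apply: ler_sum => t /andP[/andP[it _] _].
    by apply: term; exact: leq_trans it.
  rewrite sum_geometric//; last by rewrite lt_eqF.
  have -> : (rho ^+ k - rho ^+ i) / (rho - 1) = (1 - rho)^-1 * (rho ^+ i - rho ^+ k).
    by field; rewrite subr_eq0 gt_eqF//= subr_eq0 lt_eqF.
  apply: ler_wpM2l; first by rewrite invr_ge0 subr_ge0 ltW.
  by rewrite gerBl exprn_ge0// ltW.
suff : - (kappa + e) <= 1 - th - th by rewrite /th /e; lra.
(* The extra power of 2 absorbs the passage from [i.+2] to [i]. *)
apply: (@le_exponent (C * 2 `^ (2 * (kappa + e))) _ _ i0) => i ii.
have /andP[h _] := hi i.+2 (leq_trans ii (leqW (leqnSn i))).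
have /andP[_ h'] := hi i ii.
have : 2 `^ (i.+2%:R * - (kappa + e)) <= C * rho ^+ i * 2 `^ (i%:R * - th).
  apply: le_trans h _; apply: le_trans (main i ii) _; apply: ler_wpM2l => //.
  by rewrite mulr_ge0 ?exprn_ge0 ?ltW// addr_gt0 ?invr_gt0 ?subr_gt0.
rewrite /rho exp2X -mulrA -exp2D => hh.
have -> : i%:R * - (kappa + e) = i.+2%:R * - (kappa + e) + 2 * (kappa + e).
  by rewrite -[i.+2]addn2 natrD; ring.
rewrite exp2D mulrAC; apply: ler_wpM2r; first exact: powR_ge0.
by apply: le_trans hh _; rewrite le_eqVlt; apply/orP; left; apply/eqP; congr (_ * _ `^ _); ring.
Qed.


Section VolumeScaling.
(** [D] is the dimension, and [b] an exponent bounding from below the mean number of box vertices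
    joined to 0. *)
Variables (D : nat) (b c0 : R) (j0 : nat).
Hypothesis c0_gt0 : 0 < c0.
(* [A n] is the probability that some cluster has at least [n] vertices in a
   box of side [2 ^ j]. *)
Hypothesis volume : forall j, (j0 <= j)%N -> exists A : nat -> R,
  [/\ forall n, 0 <= A n,
      forall n, (0 < n)%N -> A (4 * n) <= A n ^+ 2,
      forall n, n%:R * A n <= 2 `^ (j%:R * D%:R) * q n &
      forall L, c0 * 2 `^ (j%:R * b) <=
        \sum_(1 <= n < L) q n + 2 `^ (j%:R * D%:R) * A L].

(* With [s := D / (1 + kappa) + e] the largest cluster of a box of volume
   [2 ^ (D j)] has size at most [2 ^ (s j)] up to a small probability, which
   [k] squarings bring below the inverse of the volume. *)
Lemma volume_exponent_lt e : kappa <= 1 -> 0 < e < 1 ->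
  b <= (D%:R / (1 + kappa) + e) * (1 - kappa + e).
Proof.
move=> k1 /andP[e0 e1]; set s := D%:R / _ + e.
have D0 : 0 <= D%:R :> R by [].
have s0 : 0 < s by rewrite /s ltr_wpDl// divr_ge0// addr_ge0// ltW.
have sD : s <= D%:R + 1.
  rewrite lerD ?(ltW e1)// ler_pdivrMr ?addr_gt0//.
  by rewrite ler_peMr// lerDl ltW.
have sk : s * (1 + kappa) = D%:R + e * (1 + kappa).
  by rewrite /s mulrDl divfK// gt_eqF// addr_gt0.
(* As [s <= D + 1], this choice gives [s * e' <= e], which makes [c] below positive. *)
pose e' := Num.min (kappa / 2) (e / (D%:R + 1)).
have e'0 : 0 < e' by rewrite lt_min !divr_gt0// ltr_wpDl.
have e'k : e' < kappa by rewrite gt_min; apply/orP; left; have := kappa_gt0; lra.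
have se' : s * e' <= e.
  apply: (@le_trans _ _ ((D%:R + 1) * (e / (D%:R + 1)))).
    by apply: ler_pM => //; [exact: ltW|exact: ltW|rewrite ge_min lexx orbT].
  by rewrite mulrC divfK// gt_eqF// ltr_wpDl.
have e'e : e' <= e.
  rewrite ge_min; apply/orP; right; rewrite ler_pdivrMr ?ltr_wpDl//.
  by rewrite mulrDr mulr1 lerDr mulr_ge0// ltW.
pose th := kappa - e'; have th0 : 0 < th by rewrite subr_gt0.
have th1 : th < 1 by rewrite /th; lra.
(* At [n = 2 ^ (s j)], the bound volume times [q n / n] on [A n] is at most [2 ^ (- c j)]. *)
pose c := s * (1 + th) - D%:R.
have c_gt0 : 0 < c.
  have : 0 < e * kappa by rewrite mulr_gt0.
  have -> : c = e * (1 + kappa) - s * e'.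
    have -> : c = s * (1 + kappa) - s * e' - D%:R by rewrite /c /th addrA mulrBr.
    by rewrite sk; move: (s * e') => ?; ring.
  by move: se'; move: (s * e') => z; lra.
have [|i0 hi] := q_exponent (e := e'); first by rewrite e'0.
(* Each squaring doubles the rate [c]; [k] of them bring it to at least [D]. *)
have [k hk] : exists k : nat, D%:R <= (2 ^ k)%:R * c.
  exists (Num.truncn (D%:R / c)).+1; rewrite -ler_pdivrMr//.
  apply: (le_trans (ltW (truncnS_gt _))); rewrite ler_nat; exact/ltnW/ltn_expl.
pose rho : R := 2 `^ (1 - th).
have rho1 : 1 < rho by apply: exp2_gt1; lra.
have rho0 : 0 < rho by exact: exp2_gt0.
(* The factor [2 ^ i0] covers the scales below [i0], where only [q <= 1] is known. *)
have term t : 2 `^ t%:R * q (2 ^ t) <= 2 `^ i0%:R * rho ^+ t.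
  have [/hi /andP[_ h]|ti] := leqP i0 t.
    apply: (@le_trans _ _ (2 `^ t%:R * 2 `^ (t%:R * - th))).
      by rewrite ler_wpM2l ?powR_ge0.
    apply: (@le_trans _ _ (rho ^+ t)).
      by rewrite -exp2D /rho exp2X le_eqVlt; apply/orP; left; apply/eqP; congr (_ `^ _); ring.
    apply: ler_peMl; first by rewrite exprn_ge0// ltW.
    by rewrite -[leLHS](powRr0 2) le_exp2.
  apply: (@le_trans _ _ (2 `^ t%:R)); first by rewrite ler_piMr ?powR_ge0.
  apply: (@le_trans _ _ (2 `^ i0%:R)); first by rewrite le_exp2// ler_nat ltnW.
  by rewrite ler_peMr ?powR_ge0// exprn_ege1// ltW.
pose C := 2 `^ i0%:R / (rho - 1).
have C0 : 0 < C by rewrite divr_gt0 ?exp2_gt0// subr_gt0.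
(* As [th < 1], the ratio [rho] exceeds 1 and the last scale dominates the sum. *)
have sumq m : \sum_(1 <= n < 2 ^ m) q n <= C * rho ^+ m.
  apply: le_trans (@dyadic_sum 0 m (leq0n _)) _.
  apply: (@le_trans _ _ (\sum_(0 <= t < m) 2 `^ i0%:R * rho ^+ t)).
    by apply: ler_sum => t _.
  rewrite -mulr_sumr sum_geometric//; last by rewrite gt_eqF.
  rewrite expr0 /C -mulrA; apply: ler_wpM2l; first exact: powR_ge0.
  rewrite mulrC; apply: ler_wpM2l; first by rewrite invr_ge0 subr_ge0 ltW.
  by rewrite gerBl.
suff : b <= s * (1 - th).
  move/le_trans; apply; apply: ler_wpM2l; first exact: ltW.
  by rewrite /th; lra.
pose j1 := maxn j0 (Num.truncn (i0%:R / s)).+1.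
(* The sum is cut at [L = 2 ^ (i + 2 k)] with [i <= j s + 1], hence the power [2 k + 1] of [rho];
   the final 1 bounds the volume times [A L]. *)
apply: (@le_exponent (c0^-1 * (C * rho ^+ (k.*2).+1 + 1)) _ _ j1) => j jj.
have jj0 : (j0 <= j)%N by apply: leq_trans jj; exact: leq_maxl.
have ji : i0%:R <= j%:R * s.
  rewrite -ler_pdivrMr//; apply: (le_trans (ltW (truncnS_gt _))).
  by rewrite ler_nat; apply: leq_trans jj; exact: leq_maxr.
pose i := (Num.truncn (j%:R * s)).+1.
have js0 : 0 <= j%:R * s by rewrite mulr_ge0// ltW.
have isj : j%:R * s <= i%:R <= j%:R * s + 1.
  have /andP[h1 h2] := truncn_itv js0.
  by rewrite (ltW h2) /i -natr1 lerD2r h1.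
have /andP[is1 is2] := isj.
have ii : (i0 <= i)%N by rewrite -(ler_nat R) (le_trans ji).
have [A [A0 AA Aq AL]] := volume jj0.
have Ai : A (2 ^ i)%N <= 2 `^ (- (j%:R * c)).
  have := Aq (2 ^ i)%N; rewrite natrX2 mulrC -ler_pdivlMr ?exp2_gt0//.
  move=> /le_trans; apply; rewrite -mulrA.
  have /andP[_ h] := hi i ii.
  apply: (@le_trans _ _ (2 `^ (j%:R * D%:R) * (2 `^ (i%:R * - th) / 2 `^ i%:R))).
    by rewrite ler_wpM2l ?powR_ge0// ler_wpM2r ?invr_ge0 ?powR_ge0.
  rewrite -powRN -!exp2D; apply: le_exp2.
  rewrite (_ : j%:R * D%:R + _ = j%:R * D%:R - i%:R * (1 + th)); last by ring.
  have : j%:R * s * (1 + th) <= i%:R * (1 + th) by rewrite ler_wpM2r// addr_ge0// ltW.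
  by rewrite /c; nra.
(* Each squaring costs a factor 4 in size, that is two dyadic scales. *)
have Ak m : A (2 ^ (i + m.*2))%N <= A (2 ^ i)%N ^+ (2 ^ m).
  elim: m => [|m IH]; first by rewrite addn0 expr1.
  have -> : (2 ^ (i + m.+1.*2) = 4 * 2 ^ (i + m.*2))%N.
    by rewrite doubleS !addnS !expnS mulnA.
  apply: le_trans (AA _ _) _; first by rewrite expn_gt0.
  by rewrite expnSr exprM; apply: lerXn2r; rewrite ?nnegrE ?exprn_ge0.
have Asmall : 2 `^ (j%:R * D%:R) * A (2 ^ (i + k.*2))%N <= 1.
  apply: (@le_trans _ _ (2 `^ (j%:R * D%:R) * (2 `^ (- (j%:R * c))) ^+ (2 ^ k))).
    rewrite ler_wpM2l ?powR_ge0//; apply: le_trans (Ak k) _.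
    by apply: lerXn2r; rewrite ?nnegrE ?powR_ge0.
  rewrite exp2X -exp2D -[leRHS](powRr0 2); apply: le_exp2.
  have : j%:R * D%:R <= j%:R * ((2 ^ k)%:R * c) by rewrite ler_wpM2l.
  by lra.
have := AL (2 ^ (i + k.*2))%N; rewrite mulrC -ler_pdivlMr// => /le_trans; apply.
rewrite mulrC -mulrA; apply: ler_wpM2l; first by rewrite invr_ge0 ltW.
rewrite mulrDl mul1r; apply: lerD.
  apply: le_trans (sumq _) _; rewrite -mulrA; apply: ler_wpM2l; first exact: ltW.
  rewrite /rho !exp2X -exp2D; apply: le_exp2.
  rewrite (_ : j%:R * (s * (1 - th)) = j%:R * s * (1 - th)); last by ring.
  rewrite -mulrDl; apply: ler_wpM2r; first by lra.
  by rewrite natrD -natr1; lra.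
apply: le_trans Asmall _; rewrite -[leLHS](powRr0 2); apply: le_exp2.
by rewrite !mulr_ge0// ?ltW//; lra.
Qed.

(** The limit [e -> 0] of the previous bound, whose error is at most [e * (D + 2)]; [e] is chosen to
    make this at most half of a supposed gap [b - Y]. *)
Lemma volume_exponent_le : kappa <= 1 -> b <= D%:R * (1 - kappa) / (1 + kappa).
Proof.
move=> k1; rewrite leNgt; apply/negP => bY.
set Y := D%:R * _ / _ in bY.
have D0 : 0 <= D%:R :> R by [].
pose e := Num.min (2^-1) ((b - Y) / (2 * (D%:R + 2))).
have e0 : 0 < e.
  by rewrite lt_min invr_gt0 ltr0n/= divr_gt0 ?subr_gt0// mulr_gt0// ltr_wpDl.
have e1 : e < 1 by rewrite gt_min; apply/orP; left; lra.
have eY : e * (D%:R + 2) <= (b - Y) / 2.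
  apply: (@le_trans _ _ ((b - Y) / (2 * (D%:R + 2)) * (D%:R + 2))).
    by rewrite ler_wpM2r ?addr_ge0// ge_min lexx orbT.
  by rewrite le_eqVlt; apply/orP; left; apply/eqP; field; rewrite gt_eqF// ltr_wpDl.
have := volume_exponent_lt k1; move=> /(_ e); rewrite e0 e1 => /(_ isT).
set z := D%:R / (1 + kappa).
have -> : (z + e) * (1 - kappa + e) = Y + e * (z + (1 - kappa) + e).
  by rewrite /Y /z; field; rewrite gt_eqF// addr_gt0.
have zD : z <= D%:R by rewrite ler_pdivrMr ?addr_gt0// ler_peMr// lerDl ltW.
have : e * (z + (1 - kappa) + e) <= e * (D%:R + 2).
  by rewrite ler_wpM2l ?(ltW e0)//; have := kappa_gt0; lra.
lra.
Qed.

End VolumeScaling.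

End Dyadic.

(** * The two critical exponents *)

Lemma cluster_geE d n : cluster_ge d n = event (reach_ge setT n 0).
Proof.
apply/seteqP; split=> w; rewrite /cluster_ge /event /=.
  move=> /pcard_surjP[g g_surj].
  have /choice[f hf] : forall i, exists y, (i < n)%N -> connected_in w 0 y /\ g y = i.
    move=> i; have [i_n|] := ltnP i n; last by exists 0.
    by have [y wy gy] := g_surj i i_n; exists y.
  exists (map f (iota 0 n)); split.
  - rewrite map_inj_in_uniq ?iota_uniq// => i j; rewrite !mem_iota /= => i_n j_n fij.
    by have [_ <-] := hf i i_n; have [_ <-] := hf j j_n; rewrite fij.
  - by rewrite size_map size_iota.
  - by move=> y /mapP[i]; rewrite mem_iota /= => i_n ->; have [] := hf i i_n.
move=> [s [us sn h]].
have inj_s : {in `I_n &, injective (nth 0 s)}.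
  move=> i j; rewrite !inE /= -sn => i_n j_n /eqP; rewrite nth_uniq//.
  exact: eqP.
have := inj_card_eq inj_s; rewrite card_eq_le => /andP[_ +].
move=> /card_le_trans; apply; apply: subset_card_le => _ [i /= i_n <-].
by have [] := h (nth 0 s i); rewrite // mem_nth// sn.
Qed.

Section Asymptotics.
Variable R : realType.

(* The value [fine -oo = 0] covers the case of an empty supremum. *)
Lemma fine_beta_c_ge0 d (P : R -> probability (config d) R) :
  0 <= fine (beta_c P).
Proof.
rewrite /beta_c; set B := [set _ | _ in _].
have [->|/set0P[x Bx]] := eqVneq B classical_sets.set0; first by rewrite ereal_sup0.
apply: fine_ge0; apply: le_trans (ereal_sup_ubound Bx).
by have [b [b0 _] <-] := Bx; rewrite lee_fin.
Qed.

Lemma log_equiv_bounds (T : Type) (F : set_system T) (f g : T -> R) e :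
  Filter F -> log_equiv F f g -> 0 < e < 1 ->
  \forall t \near F, 0 < g t < 1 ->
    g t `^ (1 + e) <= f t <= g t `^ (1 - e).
Proof.
move=> FF fg /andP[e0 e1]; have /cvgrPdist_lt/(_ e e0) := fg.
apply: filterS => t ht /andP[g0 g1].
have lg : ln (g t) < 0 by rewrite ln_lt0// g0.
have {ht} /andP[h1 h2] : 1 - e < ln (f t) / ln (g t) < 1 + e.
  by move: ht; rewrite ltr_norml => /andP[h1 h2]; apply/andP; split; lra.
have lf : ln (f t) < 0.
  rewrite -(divfK (ltr0_neq0 lg) (ln (f t))) nmulr_llt0//.
  by apply: lt_trans h1; lra.
(* [ln] takes the value 0 at nonpositive reals, which [ln (f t) < 0] excludes. *)
have f0 : 0 < f t.
  by rewrite ltNge; apply/negP => /ln0 e'; move: lf; rewrite e' ltxx.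
rewrite -[f t]lnK ?posrE//  /powR gt_eqF//= !ler_expR.
rewrite -(divfK (ltr0_neq0 lg) (ln (f t))) !ler_nM2r//.
by rewrite (ltW h1) (ltW h2).
Qed.

Lemma log_equiv_neg (T : Type) (F : set_system T) (f g : T -> R) :
  ProperFilter F -> log_equiv F f g ->
  (\forall t \near F, ln (f t) / ln (g t) <= 0) -> False.
Proof.
move=> FF fg h; have /cvgrPdist_lt/(_ 1 ltr01) h' := fg.
have [t [h1 /= h2]] := filter_ex (filterI h h').
by move: h2; rewrite ltr_norml => /andP[_ h2]; lra.
Qed.

End Asymptotics.

(** * A box at distance comparable to its side from the origin *)

Section Box.
Variables (R : realType) (d : nat).
Implicit Types r : nat.

(** Coordinates run from [r] to [2 r - 1], so that every vertex of the box is far from 0 and the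
    two-point asymptotics apply to all of them. *)
Definition box_point r (f : {ffun 'I_d -> 'I_r}) : lattice d :=
  \row_i (r + f i)%:Z.

Definition box r : seq (lattice d) := [seq box_point f | f : {ffun 'I_d -> 'I_r}].

Lemma box_point_inj r : injective (@box_point r).
Proof.
move=> f g fg; apply/ffunP => i; apply/val_inj.
have := congr1 (fun x : lattice d => x 0 i) fg; rewrite !mxE => -[].
exact: addnI.
Qed.

Lemma box_uniq r : uniq (box r).
Proof. by rewrite map_inj_uniq ?enum_uniq//; exact: box_point_inj. Qed.

Lemma size_box r : size (box r) = (r ^ d)%N.
Proof. by rewrite size_map -cardE card_ffun !card_ord. Qed.

Lemma euclidean_norm_box r x : (0 < d)%N -> x \in box r ->
  r%:R <= euclidean_norm R x <= (2 * d * r)%:R.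
Proof.
move=> d0 /mapP[f _ ->].
have x_ge i : (r%:R : R) ^+ 2 <= (box_point f 0 i)%:~R ^+ 2.
  by rewrite mxE -pmulrn lerXn2r ?nnegrE// ler_nat leq_addr.
have x_le i : (box_point f 0 i)%:~R ^+ 2 <= (2 * r)%:R ^+ 2 :> R.
  rewrite mxE -pmulrn lerXn2r ?nnegrE// ler_nat.
  by rewrite mul2n -addnn leq_add2l ltnW.
have n0 n : 0 <= n%:R :> R by [].
apply/andP; split.
  rewrite -[leLHS]ger0_norm// -sqrtr_sqr; apply: ler_wsqrtr.
  rewrite (bigD1 (Ordinal d0))//= ler_wpDr//.
  by apply: sumr_ge0 => i _; exact: sqr_ge0.
rewrite -[leRHS]ger0_norm// -sqrtr_sqr; apply: ler_wsqrtr.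
apply: (@le_trans _ _ (\sum_(i < d) (2 * r)%:R ^+ 2)); first exact: ler_sum.
rewrite sumr_const card_ord -!natrX -mulrnA ler_nat.
by rewrite mulnAC [X in (_ <= X)%N]expnMn leq_mul2l -mulnn leq_pmulr// orbT.
Qed.

End Box.

(** * The two exponents along powers of two *)

Section Exponents.
Variables (R : realType) (d : nat).
Hypothesis d_gt0 : (0 < d)%N.

Lemma tail_exponent_dyadic (q : nat -> R) (delta : R) : 0 < delta ->
  log_equiv \oo q (fun n : nat => n%:R `^ (- 1 / delta)) ->
  forall e, 0 < e < delta^-1 -> exists i0 : nat, forall i : nat, (i0 <= i)%N ->
    2 `^ (i%:R * - (delta^-1 + e)) <= q (2 ^ i)%N <= 2 `^ (i%:R * - (delta^-1 - e)).
Proof.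
move=> delta0 qd e /andP[e0 ek].
have k0 : 0 < delta^-1 by rewrite invr_gt0.
(* A relative error [e * delta] in the exponent [1 / delta] is an absolute error [e]. *)
have eps : 0 < e * delta < 1.
  by rewrite mulr_gt0//= -ltr_pdivlMr// div1r.
have [N _ hN] := log_equiv_bounds _ qd eps.
exists (maxn N 1) => i; rewrite geq_max => /andP[Ni i1].
have := hN (2 ^ i)%N (leq_trans Ni (ltnW (ltn_expl i (isT : 1 < 2)%N))).
have -> : (2 ^ i)%:R `^ (- 1 / delta) = 2 `^ (i%:R * - delta^-1) :> R.
  by rewrite natrX2 -powRrM mulN1r.
rewrite -!powRrM exp2_gt0 exp2_lt1/=; last by rewrite pmulr_rlt0 ?oppr_lt0// ltr0n.
have -> : i%:R * - (delta^-1 + e) = i%:R * - delta^-1 * (1 + e * delta).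
  by field; rewrite gt_eqF.
have -> : i%:R * - (delta^-1 - e) = i%:R * - delta^-1 * (1 - e * delta).
  by field; rewrite gt_eqF.
exact.
Qed.

Lemma euclidean_normN (x : lattice d) : euclidean_norm R (- x) = euclidean_norm R x.
Proof.
by congr (Num.sqrt _); apply: eq_bigr => i _; rewrite mxE mulrNz sqrrN.
Qed.

Lemma box_nonempty r : (0 < r)%N -> exists x, x \in box d r.
Proof.
move=> r0; exists (box_point [ffun=> Ordinal r0]); apply: map_f; exact: mem_enum.
Qed.

#[local] Instance far_apart_proper : ProperFilter (far_apart R d).
Proof.
apply: filter_from_proper => M _.
have [x xb] := box_nonempty (ltn0Sn (Num.truncn M)).
exists (x, 0); rewrite /= subr0; have /andP[+ _] := euclidean_norm_box R d_gt0 xb.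
by apply: lt_le_trans; exact: truncnS_gt.
Qed.

Variables (f : lattice d * lattice d -> R) (a : R).
Hypothesis f_le1 : forall xy, f xy <= 1.
Hypothesis f_exponent :
  log_equiv (far_apart R d) f (fun xy => euclidean_norm R (xy.1 - xy.2) `^ a).

(** Since [f <= 1], an exponent [a >= 0] would make the ratio of logarithms nonpositive at large
    distance, where it tends to 1. *)
Lemma two_point_exponent_lt0 : a < 0.
Proof.
rewrite ltNge; apply/negP => a0.
apply: (log_equiv_neg (F := far_apart R d) _ f_exponent).
exists 1 => // xy /= xy1; rewrite ln_powR.
rewrite mulr_le0_ge0 ?invr_ge0 ?mulr_ge0 ?ln_ge0 ?(ltW xy1)//.
exact: ln_le0.
Qed.

(** The box has [r ^ d] vertices of norm at most [2 d r], with [r = 2 ^ j]; as the exponent is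
    negative, each term is at least the power of [2 d r]. *)
Lemma sum_two_point_box e : 0 < e < 1 ->
  exists c0 j0, 0 < c0 /\ forall j : nat, (j0 <= j)%N ->
    c0 * 2 `^ (j%:R * (d%:R + a * (1 + e))) <= \sum_(x <- box d (2 ^ j)) f (0, x).
Proof.
move=> e01; have [M _ hM] := log_equiv_bounds _ f_exponent e01.
have a0 := two_point_exponent_lt0; have /andP[e0 e1] := e01.
pose b := a * (1 + e); have b0 : b < 0 by rewrite /b nmulr_rlt0// addr_gt0.
exists ((2 * d)%:R `^ b), (Num.truncn (Num.max M 1)).+1; split.
  by rewrite powR_gt0// ltr0n muln_gt0.
move=> j jM.
have r_gt : Num.max M 1 < (2 ^ j)%:R.
  apply: (lt_le_trans (truncnS_gt _)); rewrite ler_nat.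
  exact: leq_trans (ltnW (ltn_expl j (isT : 1 < 2)%N)).
have [M_lt r_gt1] : M < (2 ^ j)%:R /\ 1 < (2 ^ j)%:R :> R.
  by move: r_gt; rewrite gt_max => /andP[].
have lower x : x \in box d (2 ^ j) -> (2 * d * 2 ^ j)%:R `^ b <= f (0, x).
  move=> /(euclidean_norm_box R d_gt0)/andP[x_ge x_le].
  have := hM (0, x); rewrite /= sub0r euclidean_normN => /(_ (lt_le_trans M_lt x_ge)).
  have n1 := lt_le_trans r_gt1 x_ge; have n0 := lt_trans ltr01 n1.
  rewrite powR_gt0//= -[X in _ < X -> _](powRr0 (euclidean_norm R x)).
  have -> : euclidean_norm R x `^ a < euclidean_norm R x `^ 0.
    by rewrite /powR gt_eqF//= ltr_expR mul0r nmulr_rlt0// ln_gt0.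
  move=> /(_ isT)/andP[+ _]; apply: le_trans.
  rewrite -powRrM -/b /powR !gt_eqF//; last first.
    by rewrite ltr0n !muln_gt0 d_gt0 expn_gt0.
  by rewrite /= ler_expR ler_nM2l// ler_ln// posrE// (lt_le_trans n0).
rewrite mulrDr exp2D.
apply: (@le_trans _ _ (\sum_(x <- box d (2 ^ j)) (2 * d * 2 ^ j)%:R `^ b)).
  rewrite big_const_seq count_predT size_box iter_addr_0 (natrM _ (2 * d)) powRM//.
  rewrite -[_ *+ ((2 ^ j) ^ d)]mulr_natr natrX2 -powRrM -expnM natrX2 (natrM _ j d).
  by rewrite -/b -[leRHS]mulrA [2 `^ (j%:R * b) * _]mulrC.
by rewrite big_seq [leRHS]big_seq; apply: ler_sum.
Qed.

End Exponents.

Theorem mainTheorem3 (R : realType) (d : nat) (J : lattice d -> R)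
    (P : R -> probability (config d) R) (delta eta : R)
    (d_ge1 : (1 <= d)%N)
    (J_ge0 : forall x : lattice d, 0 <= J x)
    (J_sym : forall x : lattice d, J (- x) = J x)
    (J_int : (\esum_(x in [set: lattice d]) (J x)%:E < +oo)%E)
    (P_law : forall beta : R, 0 <= beta -> percolation_law J beta (P beta))
    (beta_c_fin : (beta_c P < +oo)%E)
    (delta_gt0 : 0 < delta)
    (delta_exponent :
      log_equiv \oo
        (fun n : nat => fine (P (fine (beta_c P)) (cluster_ge d n)))
        (fun n : nat => n%:R `^ (- 1 / delta)))
    (eta_exponent :
      log_equiv (far_apart R d)
        (fun xy => fine (P (fine (beta_c P)) (connection xy.1 xy.2)))
        (fun xy => euclidean_norm R (xy.1 - xy.2) `^ (- d%:R + 2 - eta))) :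
  (2 - eta) * (delta + 1) <= d%:R * (delta - 1).
Proof.
set mu := P (fine (beta_c P)) in delta_exponent eta_exponent.
have law : percolation_law J (fine (beta_c P)) mu by exact/P_law/fine_beta_c_ge0.
have indep : mutually_independent mu (@open_edge d) by case: law.
pose q := cluster_tail mu.
have q0 n : 0 <= q n by exact: pr_ge0.
have q1 n : q n <= 1.
  by apply: pr_le1; [exact: increasing_reach_ge|exact: finitary_reach_ge].
have q_anti n m : (n <= m)%N -> q m <= q n by exact: pr_reach_geW.
have q_exp : log_equiv \oo q (fun n : nat => n%:R `^ (- 1 / delta)).
  by apply: cvg_trans delta_exponent; apply: near_eq_cvg; apply: nearW => n;
    rewrite cluster_geE.
have kappa0 : 0 < delta^-1 by rewrite invr_gt0.
have tail := tail_exponent_dyadic delta_gt0 q_exp.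
have kappa1 : delta^-1 <= 1.
  apply: (kappa_le1 q0 q_anti tail) => n c n0 hc.
  (* Replacing 3 by 4 keeps all sizes dyadic. *)
  apply: (@le_trans _ _ (q (3 * n)%N)); first by apply: q_anti; rewrite leq_mul2r orbT.
  apply: (pr_reach_ge_split indep law n0) => s us.
  apply: le_trans (hc (n + size s).+1 _); last by rewrite -addnS leq_addr.
  (* Bounds the probability that the cluster of 0 has [k] vertices in [s] and at least [n] in all.
     The terms below [n] add up to at most [n * q n]. *)
  pose f k := if (k < n)%N then q n else q k.
  have f0 k : 0 <= f k by rewrite /f; case: ifP.
  apply: le_trans (sum_pr_connected us (f := f) _ _ _) _.
  - exact: increasing_reach_ge.
  - exact: finitary_reach_ge.
  - move=> k k0; rewrite /f.
    have uI : increasing (fun w => reach_ge [set` s] k (0 : lattice d) w /\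
        reach_ge setT n (0 : lattice d) w).
      by apply: increasingI; exact: increasing_reach_ge.
    have fI : finitary (fun w => reach_ge [set` s] k (0 : lattice d) w /\
        reach_ge setT n (0 : lattice d) w).
      by apply: finitaryI; try exact: increasing_reach_ge; exact: finitary_reach_ge.
    case: ifP => _; apply: le_pr => //; try exact: increasing_reach_ge;
      try exact: finitary_reach_ge; first by move=> w [].
    by move=> w [h _]; exact: reach_ge_sub h.
  rewrite -(big_mkord predT (fun k => f k.+1)) -(big_add1 _ _ _ (size s).+1 predT f).
  apply: (@le_trans _ _ (\sum_(1 <= k < (n + size s).+1) f k)).
    rewrite [leRHS](@big_cat_nat _ _ _ (size s).+1)//= ?ltnS ?leq_addl//.
    by rewrite lerDl; apply: sumr_ge0.
  rewrite (@big_cat_nat _ _ _ n)//=; last by rewrite -addnS leq_addr.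
  apply: lerD; last first.
    rewrite big_nat_cond [leRHS]big_nat_cond; apply: ler_sum => k /andP[/andP[nk _] _].
    by rewrite /f ltnNge nk.
  apply: (@le_trans _ _ (\sum_(1 <= k < n) q n)).
    rewrite big_nat_cond [leRHS]big_nat_cond; apply: ler_sum => k /andP[/andP[_ kn] _].
    by rewrite /f kn.
  by rewrite big_const_nat iter_addr_0 -[q n *+ _]mulr_natl ler_wpM2r// ler_nat leq_subr.
pose tau xy := fine (mu (connection xy.1 xy.2)).
have tau1 xy : tau xy <= 1.
  by apply: pr_le1; [exact: increasing_connected_in|exact: finitary_connected_in].
pose a : R := - d%:R + 2 - eta.
have a0 : a < 0 := two_point_exponent_lt0 d_ge1 tau1 eta_exponent.
have volume e : 0 < e < 1 ->
    d%:R + a * (1 + e) <= d%:R * (1 - delta^-1) / (1 + delta^-1).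
  move=> e01; have [c0 [j0 [c00 lower]]] := sum_two_point_box d_ge1 tau1 eta_exponent e01.
  apply: (volume_exponent_le (j0 := j0) q1 q_anti kappa0 tail c00 _ kappa1) => j jj0.
  have sizeE : (size (box d (2 ^ j)))%:R = 2 `^ (j%:R * d%:R) :> R.
    by rewrite size_box -expnM natrX2 natrM.
  exists (fun n => pr mu (max_reach [set` box d (2 ^ j)] n)); split.
  - by move=> n; exact: pr_ge0.
  - move=> n n0; apply: le_trans (pr_max_reach indep _ n0).
    apply: le_pr; try exact: increasing_max_reach; try exact: finitary_max_reach.
    by move=> w [x h]; exists x; apply: reach_geW h; rewrite leq_mul2r orbT.
  - by move=> n; rewrite -sizeE; exact: (pr_max_reach_markov indep law).
  - move=> L; rewrite -sizeE; apply: le_trans (lower j jj0) _.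
    exact: (sum_pr_two_point mu (box_uniq d (2 ^ j)) L).
have : d%:R + a <= d%:R * (1 - delta^-1) / (1 + delta^-1).
  rewrite leNgt; apply/negP; set Y := d%:R * _ / _ => aY.
  (* The limit [e -> 0]: the loss [- a * e] is at most half of the supposed gap. *)
  pose e := Num.min (2^-1) ((d%:R + a - Y) / (- (2 * a))).
  have e0 : 0 < e by rewrite lt_min invr_gt0 ltr0n/= divr_gt0 ?subr_gt0//; lra.
  have e1 : e < 1 by rewrite gt_min; apply/orP; left; lra.
  have := volume e; rewrite e0 e1 => /(_ isT); rewrite -/Y.
  have : e * - (2 * a) <= d%:R + a - Y.
    by rewrite -ler_pdivlMr ?ge_min ?lexx ?orbT//; lra.
  by lra.
have -> : d%:R * (1 - delta^-1) / (1 + delta^-1) = d%:R * (delta - 1) / (delta + 1).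
  by field; rewrite !gt_eqF//= addr_gt0.
(* By definition of [a], the left factor [d + a] is [2 - eta]. *)
rewrite ler_pdivlMr ?addr_gt0//; congr (_ * _ <= _).
by rewrite /a; ring.
Qed.
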